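(* (i) For all integers $n\ge1$ and complex $z,y,\beta$ such that $\beta^2\notin\{1,q^{-1},\ldots\}$, $$0=\sum_{j=0}^n\begin{bmatrix}n\\ j\end{bmatrix}_q(\beta^2q^j)_{n-1}\,p_j(z|y,\beta,q)\,g_{n-j}(z|y,\beta q^{n-1},q),$$ $$0=\sum_{j=0}^n\begin{bmatrix}n\\ j\end{bmatrix}_q\frac{p_{n-j}(z|y,\beta q^j,q)\,g_j(z|y,\beta q^{j-1},q)\,(1-\beta^2q^{2j-1})}{(\beta^2q^{j-1})_n(1-\beta^2q^{n+j-1})}.$$ In particular, for $z=y=0$ one gets the identities (valid for all $n\ge1$ and $\beta\notin\{1,q^{-1},\ldots\}$) $$0=\sum_{k=0}^n(-1)^kq^{\binom k2}\begin{bmatrix}n\\ k\end{bmatrix}_q(\beta q^{n-k})_{n-1},\qquad 0=\sum_{k=0}^n(-1)^kq^{\binom k2}\begin{bmatrix}n\\ k\end{bmatrix}_q\frac{1-\beta q^{2k}}{(\beta q^k)_{n+1}} .$$ (ii) For $|y|,|z|,|\rho_1|,|\rho_2|,|q|<1$ (and $x\in[-1,1]$) we have $$f_{CN}(x|z,\rho_2,q)=f_{CN}(z|y,\rho_1\rho_2,q)\sum_{n\ge0}\frac{\rho_2^n}{(\rho_1^2\rho_2^2)_n(q)_n}\,p_n(z|y,\rho_1\rho_2,q)\,p_n(x|y,\rho_1,q),$$ $$f_{CN}(z|y,\rho_1\rho_2,q)=f_{CN}(x|z,\rho_2,q)\sum_{n\ge0}\frac{\rho_2^n(\rho_1^2\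rho_2^2)_{2n}\prod_{j=0}^{n-1}w(y,z|\rho_1\rho_2q^j)}{(\rho_1^2\rho_2^2q^{n-1})_n^2\,(\rho_2^2,q)_n}\,g_n(z|y,\rho_1\rho_2q^{n-1},q)\,\alpha_n(x|y,\rho_1,z,\rho_2,q).$$
   Context: $q$ is a parameter, $-1<q\le1$. $(a)_n=\prod_{j=0}^{n-1}(1-aq^j)$, $(a)_\infty=\prod_{j\ge0}(1-aq^j)$, $(a,b)_n=(a)_n(b)_n$, $\begin{bmatrix}n\\ k\end{bmatrix}_q=\frac{(q)_n}{(q)_k(q)_{n-k}}$ (the ordinary binomial coefficient for $q=1$); empty products equal $1$. In the second identity of (i) the $j=0$ term is read after cancelling the common factor $1-\beta^2q^{-1}$. Put $$w(x,y|a)=(1-a^2)^2-4xya(1+a^2)+4a^2(x^2+y^2),\qquad l(x|a)=(1+a)^2-4x^2a .$$ Al-Salam–Chihara polynomials: $p_{-1}=0$, $p_0=1$, $p_{n+1}(x|y,\rho,q)=2(x-\rho yq^n)p_n(x|y,\rho,q)-(1-\rho^2q^{n-1})(1-q^n)p_{n-1}(x|y,\rho,q)$. Continuous $q$-Hermite polynomials: $h_0=1$, $h_1=2x$, $h_n(x|q)=2xh_{n-1}(x|q)-(1-q^{n-1})h_{n-2}(x|q)$. Further $b_n(x|q)=(-1)^nq^{\binom n2}h_n(x|q^{-1})$ for $q\neq0$, and $b_0(x|0)=b_2(x|0)=1$, $b_1(x|0)=-2x$, $b_n(x|0)=0$ for $n\ge3$; $g_n(x|y,\rho,q)=\rho^np_n(y|x,\rho^{-1},q)$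 if $\rho\ne0$, $g_n(x|y,0,q)=b_n(x|q)$, and $g_0=1$. Densities on $[-1,1]$: $$f_h(x|q)=\frac{2(q)_\infty\sqrt{1-x^2}}\pi\prod_{k=1}^\infty l(x|q^k),\qquad f_{CN}(x|y,\rho,q)=f_h(x|q)\frac{(\rho^2)_\infty}{\prod_{j=0}^\infty w(x,y|\rho q^j)} .$$ $\alpha_n(x|y,\rho_1,z,\rho_2,q)$ are the Askey–Wilson polynomials with parameters $a,b,c,d$ given by $a+b=2\rho_1y$, $ab=\rho_1^2$, $c+d=2\rho_2z$, $cd=\rho_2^2$, explicitly $$\alpha_n(x|y,\rho_1,z,\rho_2,q)=\sum_{j=0}^n\begin{bmatrix}n\\ j\end{bmatrix}_q\frac{\rho_2^{n-j}(\rho_1^2q^j)_{n-j}}{(\rho_1^2\rho_2^2q^{n+j-1})_{n-j}}\,g_{n-j}(z|y,\rho_1\rho_2q^{n-1},q)\,p_j(x|y,\rho_1,q).$$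
   Formalization: In (ii), false as printed (take x=1), f_CN(x|z,ρ2,q) is replaced by f_CN(z|x,ρ2,q) in both identities; in the second, the product of w(y,z|ρ1ρ2q^j) is moved to the denominator and the factor (ρ1²ρ2²q^{n-1})_n² is removed. *)

(* Defs.v *)
From mathcomp Require Import all_boot all_order all_algebra.
From mathcomp Require Import complex.
From mathcomp Require Import all_classical all_reals all_analysis.
Set Implicit Arguments.
Unset Strict Implicit.
Unset Printing Implicit Defensive.
Import Order.TTheory GRing.Theory Num.Theory.
Import numFieldNormedType.Exports.
Local Open Scope ring_scope.

(* The polynomial families are defined over an arbitrary field, so that they
   can be evaluated both at complex and at real arguments. *)

Definition qpoch (F : fieldType) (a q : F) (n : nat) : F :=
  \prod_(j < n) (1 - a * q ^+ j).

Definition qbinom (F : fieldType) (q : F) (n k : nat) : F :=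
  if q == 1 then 'C(n, k)%:R
  else qpoch q q n / (qpoch q q k * qpoch q q (n - k)).

Definition AWw (F : fieldType) (x y a : F) : F :=
  (1 - a ^+ 2) ^+ 2 - 4 * x * y * a * (1 + a ^+ 2)
  + 4 * a ^+ 2 * (x ^+ 2 + y ^+ 2).

Definition AWl (F : fieldType) (x a : F) : F :=
  (1 + a) ^+ 2 - 4 * x ^+ 2 * a.

(* Al-Salam--Chihara polynomials p_n(x|y,rho,q).  The index -1 of the
   three-term recurrence only occurs at p_1, with coefficient 1 - q^0 = 0. *)
Fixpoint ASC (F : fieldType) (x y rho q : F) (n : nat) : F :=
  match n with
  | 0 => 1
  | m.+1 => 2 * (x - rho * y * q ^+ m) * ASC x y rho q m
            - match m with
              | 0 => 0
              | k.+1 => (1 - rho ^+ 2 * q ^+ k) * (1 - q ^+ k.+1)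
                        * ASC x y rho q k
              end
  end.

(* Continuous q-Hermite polynomials h_n(x|q), with the same convention. *)
Fixpoint qHermite (F : fieldType) (x q : F) (n : nat) : F :=
  match n with
  | 0 => 1
  | m.+1 => 2 * x * qHermite x q m
            - match m with
              | 0 => 0
              | k.+1 => (1 - q ^+ k.+1) * qHermite x q k
              end
  end.

Definition bpol (F : fieldType) (x q : F) (n : nat) : F :=
  if q == 0 then
    match n with
    | 0 => 1
    | 1 => - (2 * x)
    | 2 => 1
    | _ => 0
    end
  else (-1) ^+ n * q ^+ 'C(n, 2) * qHermite x q^-1 n.

(* g_n(x|y,rho,q); note that x and y are exchanged in the Al-Salam--Chihara
   polynomial.  As g_0 = 1 whatever rho is, the value of rho at n = 0 is
   immaterial in expressions such as g_n(z|y,beta q^(n-1),q). *)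
Definition gpol (F : fieldType) (x y rho q : F) (n : nat) : F :=
  if n == 0%N then 1
  else if rho == 0 then bpol x q n
  else rho ^+ n * ASC y x rho^-1 q n.

(* Askey--Wilson polynomials alpha_n(x|y,rho1,z,rho2,q).  The truncated
   exponents n - 1 and n + j - 1 differ from the true ones only for n = j = 0,
   where they occur in an empty product and in g_0 = 1. *)
Definition AWalpha (F : fieldType) (x y rho1 z rho2 q : F) (n : nat) : F :=
  \sum_(j < n.+1)
    qbinom q n j
    * (rho2 ^+ (n - j) * qpoch (rho1 ^+ 2 * q ^+ j) q (n - j)
       / qpoch (rho1 ^+ 2 * rho2 ^+ 2 * q ^+ (n + j).-1) q (n - j))
    * gpol z y (rho1 * rho2 * q ^+ n.-1) q (n - j)
    * ASC x y rho1 q j.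

Definition infprod (R : realType) (u : nat -> R) : R :=
  limn (fun n => \prod_(j < n) u j).

Definition qpochinf (R : realType) (a q : R) : R :=
  infprod (fun j => 1 - a * q ^+ j).

(* The densities f_h(x|q) and f_CN(x|y,rho,q), used for |q| < 1 and
   -1 <= x <= 1; f_CN is a density in its first variable. *)
Definition fh (R : realType) (x q : R) : R :=
  2 * qpochinf q q * Num.sqrt (1 - x ^+ 2) / pi
  * infprod (fun k => AWl x (q ^+ k.+1)).

Definition fCN (R : realType) (x y rho q : R) : R :=
  fh x q * (qpochinf (rho ^+ 2) q / infprod (fun j => AWw x y (rho * q ^+ j))).

(* Main.v *)
Require Import Defs.
From mathcomp Require Import all_boot all_order all_algebra.
From mathcomp Require Import complex.
From mathcomp Require Import all_classical all_reals all_analysis.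
From mathcomp Require Import ring lra zify.
Import Order.TTheory GRing.Theory Num.Theory.
Import numFieldNormedType.Exports.
Local Open Scope ring_scope.
Set Implicit Arguments.
Unset Strict Implicit.
Unset Printing Implicit Defensive.

(* All families are coefficients s_n of quotients
     prod_k (1 - B q^k t + b q^2k t^2) / prod_k (1 - A q^k t + a q^2k t^2),
   which satisfy a three-term recurrence and compose under q-convolution.  The
   first identity of (i) says that two triangular matrices of such coefficients
   are inverse to each other; the second one is the same product in the other
   order.

   For (ii), Carlitz' formula
     sum_m s^m / (q)_m h_(k+m)(z) h_m(y)
       = p_k(z|y,s) / (s^2)_k  sum_m s^m / (q)_m h_m(z) h_m(y)
   follows from the recurrences in the shifts of both factors, and comparing s
   with q s gives the product form of the Poisson-Mehler kernel.  Expanding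
   h_n(x) in the p_k(x|y,rho1) yields the first expansion.  In the second one
   the reciprocal of the kernel is first expanded in b_n(z) p_n(x|z,rho2), and
   p_n(x|z,rho2) is then rewritten in terms of the alpha_m by the matrix inverse
   of (i) and the symmetry of alpha_m in (y,rho1) and (z,rho2). *)

(** * Gaussian binomial coefficients by Pascal's rule *)

Section GaussBinomial.
Variables (F : fieldType) (q : F).

(** In (i) the base may be 0, negative or 1 and the remaining parameters are complex, so the sums
    are handled without dividing by (q)_n: Gaussian binomials come from Pascal's rule, products of
    generating functions become convolutions weighted by them, and [qquot], whose parameters may
    vanish, covers p_n, g_n, b_n and h_n at once. The exceptional values of b_n at q = 0 and of g_n
    at rho = 0 then need no separate treatment. In (ii) the obstacle is the interchange of sums. For
    -1 <= x <= 1 the roots of 1 - 2xt + t^2 lie on the unit circle, so the coefficients grow more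
    slowly than every r^n with r > 1, and s^n with |s| < 1 absorbs two such factors. For alpha_m
    only a bound by a multiple of 16^m is used; it is harmless because the b_n decay faster than
    every geometric sequence. Division by a kernel is legitimate because the comparison of s with q
    s also shows that the kernel does not vanish. *)

Fixpoint gbin (n k : nat) : F :=
  match n, k with
  | _, 0 => 1
  | 0, _.+1 => 0
  | n'.+1, k'.+1 => gbin n' k' + q ^+ k'.+1 * gbin n' k'.+1
  end.

Lemma gbin0 n : gbin n 0 = 1. Proof. by case: n. Qed.

Lemma gbinS n k : gbin n.+1 k.+1 = gbin n k + q ^+ k.+1 * gbin n k.+1.
Proof. by []. Qed.

Lemma gbin_small n k : (n < k)%N -> gbin n k = 0.
Proof.
elim: n k => [|n IH] [|k] //= ltnk.
by rewrite !IH ?mulr0 ?addr0 // ltnW.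
Qed.

Lemma gbinn n : gbin n n = 1.
Proof. by elim: n => [|n IH] //=; rewrite IH gbin_small // mulr0 addr0. Qed.

Lemma gbinS_dual n k :
  (k <= n)%N -> gbin n.+1 k.+1 = q ^+ (n - k) * gbin n k + gbin n k.+1.
Proof.
elim: n k => [|n IH] k.
  by rewrite leqn0 => /eqP -> /=; rewrite mulr0 mulr1 addrC.
rewrite leq_eqVlt ltnS => /orP[/eqP ->|lekn].
  by rewrite subnn mul1r !gbinn gbin_small // addr0.
case: k => [|k] in lekn *.
  rewrite gbinS {1}IH // [in RHS]gbinS !gbin0 !subn0.
  by rewrite expr1 exprS; ring.
rewrite gbinS {1}(IH k) ?(ltnW lekn) // {1}(IH k.+1) //.
rewrite [gbin n.+1 k.+1 in RHS]gbinS [gbin n.+1 k.+2 in RHS]gbinS.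
have -> : (n.+1 - k.+1 = (n - k.+1).+1)%N by rewrite subSS subnSK.
have -> : (n - k = (n - k.+1).+1)%N by rewrite subnSK.
have -> : q ^+ k.+2 = q * q ^+ k.+1 by rewrite exprS.
by rewrite exprS; ring.
Qed.

(** The two Pascal rules compute the same coefficient; this is their difference. *)
Lemma gbin_mulr n k :
  (k <= n)%N -> (1 - q ^+ k.+1) * gbin n k.+1 = (1 - q ^+ (n - k)) * gbin n k.
Proof.
move=> lekn; have := gbinS_dual lekn; rewrite gbinS => e.
apply/eqP; rewrite -subr_eq0; apply/eqP.
have -> : (1 - q ^+ k.+1) * gbin n k.+1 - (1 - q ^+ (n - k)) * gbin n k =
  (q ^+ (n - k) * gbin n k + gbin n k.+1) - (gbin n k + q ^+ k.+1 * gbin n k.+1).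
  by ring.
by rewrite -e subrr.
Qed.

Lemma gbin_mulS n k :
  (k <= n)%N -> gbin n.+1 k.+1 * (1 - q ^+ k.+1) = (1 - q ^+ n.+1) * gbin n k.
Proof.
move=> lekn; rewrite gbinS mulrDl -mulrA [gbin n k.+1 * _]mulrC gbin_mulr //.
have -> : q ^+ n.+1 = q ^+ k.+1 * q ^+ (n - k) by rewrite -exprD addSn subnKC.
by ring.
Qed.

Lemma gbin_mulSr n k :
  (k <= n)%N -> gbin n.+1 k * (1 - q ^+ (n.+1 - k)) = (1 - q ^+ n.+1) * gbin n k.
Proof.
move=> lekn; case: k lekn => [|k] lekn; first by rewrite !gbin0 subn0; ring.
rewrite subSS gbinS_dual; last exact: ltnW.
rewrite mulrDl -mulrA [gbin n k * _]mulrC -gbin_mulr; last exact: ltnW.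
have -> : q ^+ n.+1 = q ^+ k.+1 * q ^+ (n - k).
  by rewrite -exprD addSn subnKC // ltnW.
by ring.
Qed.

Lemma gbin_qbinom n k : (forall m, (0 < m)%N -> q ^+ m != 1) \/ q = 1 ->
  (k <= n)%N -> qbinom q n k = gbin n k.
Proof.
rewrite /qbinom; case=> [hq|q1]; last first.
  rewrite {1}q1 eqxx => _; elim: n k => [|n IH] [|k] //.
  by rewrite gbinS binS natrD !IH {1}q1 expr1n mul1r addrC.
have qN1 : q == 1 = false by apply/negbTE; rewrite -(expr1 q) hq.
have qp m : qpoch q q m != 0.
  apply/prodf_neq0 => i _; rewrite subr_eq0 eq_sym -exprS; exact: hq.
have qpS m : qpoch q q m.+1 = qpoch q q m * (1 - q ^+ m.+1).
  by rewrite /qpoch big_ord_recr /= exprS.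
rewrite qN1; elim: k => [|k IH] lekn.
  by rewrite subn0 gbin0 /qpoch big_ord0 mul1r divff ?qp.
have h0 : 1 - q ^+ k.+1 != 0 by rewrite subr_eq0 eq_sym hq.
apply: (mulfI h0).
rewrite gbin_mulr; last exact: ltnW.
rewrite -IH; last exact: ltnW.
have -> : (n - k = (n - k.+1).+1)%N by rewrite subnSK.
have h1 : 1 - q ^+ (n - k.+1).+1 != 0 by rewrite subr_eq0 eq_sym hq.
rewrite !qpS.
move: (qp n) (qp k) (qp (n - k.+1)%N) => p1 p2 p3.
by field; rewrite h0 h1 p2 p3.
Qed.

End GaussBinomial.

Arguments gbin : simpl never.

(** * Products of series sum u_n t^n / (q)_n, written as convolutions *)

Section QConvolution.
Variables (F : fieldType) (q : F).
Implicit Types (f g : nat -> nat -> F) (n : nat).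

(** For f j k = u j * v k this is the product of the two generating functions. A function of both
    indices also accommodates factors such as q^j that occur in the middle of a computation. *)
Definition qconv f n : F := \sum_(j < n.+1) gbin q n j * f j (n - j)%N.

Lemma eq_qconv f g n :
  (forall j k, (j + k)%N = n -> f j k = g j k) -> qconv f n = qconv g n.
Proof.
move=> efg; apply: eq_bigr => j _; congr (_ * _); apply: efg.
by rewrite subnKC // -ltnS.
Qed.

Lemma qconv0 f : qconv f 0 = f 0%N 0%N.
Proof. by rewrite /qconv big_ord1 gbin0 mul1r. Qed.

Lemma qconvD f g n :
  qconv (fun j k => f j k + g j k) n = qconv f n + qconv g n.
Proof. by rewrite /qconv -big_split; apply: eq_bigr => j _; rewrite mulrDr. Qed.

Lemma qconvZ (c : F) f n : qconv (fun j k => c * f j k) n = c * qconv f n.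
Proof. by rewrite /qconv mulr_sumr; apply: eq_bigr => j _; rewrite mulrCA. Qed.

(** The q-Leibniz rule: D u(t) = (u(t) - u(qt)) / t shifts the coefficients by one, and D(uv)(t) =
    Du(t) v(t) + u(qt) Dv(t). *)
Lemma qconvS f n :
  qconv f n.+1 = qconv (fun j k => f j.+1 k + q ^+ j * f j k.+1) n.
Proof.
rewrite qconvD /qconv big_ord_recl gbin0 subn0 mul1r.
rewrite (eq_bigr (fun j : 'I_n.+1 => gbin q n j * f j.+1 (n - j)%N +
   q ^+ j.+1 * gbin q n j.+1 * f j.+1 (n - j)%N)); last first.
  by move=> j _; rewrite lift0 subSS gbinS mulrDl.
rewrite big_split /= addrCA; congr (_ + _).
rewrite [in LHS]big_ord_recr /= gbin_small // mulr0 mul0r addr0.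
rewrite [in RHS]big_ord_recl gbin0 subn0 expr0 !mul1r; congr (_ + _).
apply: eq_bigr => j _; rewrite lift0 subnSK ?ltn_ord //.
by rewrite mulrCA mulrA.
Qed.

(** Multiplication of the first factor by t, which acts on coefficients as u_n -> (1 - q^n)
    u_(n-1). *)
Lemma qconv_shiftl f n :
  qconv (fun j k => (1 - q ^+ j) * f j.-1 k) n.+1 = (1 - q ^+ n.+1) * qconv f n.
Proof.
rewrite /qconv big_ord_recl expr0 subrr mul0r mulr0 add0r mulr_sumr.
apply: eq_bigr => j _; rewrite lift0 subSS mulrA gbin_mulS ?mulrA //.
by rewrite -ltnS.
Qed.

Lemma qconv_shiftr f n :
  qconv (fun j k => (1 - q ^+ k) * f j k.-1) n.+1 = (1 - q ^+ n.+1) * qconv f n.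
Proof.
rewrite /qconv big_ord_recr /= subnn expr0 subrr mul0r mulr0 addr0 mulr_sumr.
apply: eq_bigr => j _; rewrite mulrA gbin_mulSr ?mulrA; last by rewrite -ltnS.
by rewrite subSn // -ltnS.
Qed.

End QConvolution.

(** * Coefficients of quotients of infinite products *)

Section QQuotient.
Variables (F : fieldType) (q : F).
Implicit Types (A a B b C c : F) (n : nat).

(* Coefficients, times (q)_n, of prod_k (1 - B q^k t + b q^2k t^2)
   / (1 - A q^k t + a q^2k t^2). *)
Fixpoint qquot A a B b n : F :=
  match n with
  | 0 => 1
  | m.+1 => (A - B * q ^+ m) * qquot A a B b m
            - match m with
              | 0 => 0
              | k.+1 => (a - b * q ^+ k) * (1 - q ^+ k.+1) * qquot A a B b k
              end
  end.

(** A recurrence without case distinction: at n = 0 the truncated predecessors are multiplied by 1 -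
    q^0 = 0. The same convention is used wherever [.-1] and [.-2] occur below. *)
Lemma qquotS A a B b n : qquot A a B b n.+1 =
  (A - B * q ^+ n) * qquot A a B b n
  - (a - b * q ^+ n.-1) * (1 - q ^+ n) * qquot A a B b n.-1.
Proof. by case: n => [|n] //=; rewrite expr0 subrr mulr0 mul0r. Qed.

(** The numerator of the first quotient is the denominator of the second, so they cancel in the
    product. The q-Leibniz rule and the two recurrences give the recurrence of the result, for every
    q. *)
Lemma qquot_conv A a B b C c n :
  qconv q (fun j k => qquot A a B b j * qquot B b C c k) n = qquot A a C c n.
Proof.
elim/ltn_ind: n => -[_|n IH]; first by rewrite qconv0 mulr1.
rewrite qconvS qquotS -IH // -qconvZ.
pose u := qquot A a B b; pose v := qquot B b C c.
transitivity (qconv q (fun j k => (A - C * q ^+ n) * (u j * v k) +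
   ((-1) * ((1 - q ^+ j) * ((a - b * q ^+ j.-1) * u j.-1 * v k)) +
    (-1) * ((1 - q ^+ k) * (q ^+ j * (b - c * q ^+ k.-1) * u j * v k.-1)))) n).
  apply: eq_qconv => j k <-; rewrite !qquotS -/(u j) -/(v k) exprD.
  rewrite -/(u j.-1) -/(v k.-1); ring.
rewrite !qconvD; congr (_ + _); rewrite !qconvZ.
case: n IH => [|n] IH; first by rewrite !qconv0 expr0; ring.
rewrite (qconv_shiftl q (fun j k => (a - b * q ^+ j) * u j * v k)).
rewrite (qconv_shiftr q (fun j k => q ^+ j * (b - c * q ^+ k) * u j * v k)).
rewrite -!mulrDr -qconvD -IH //= -/u -/v.
rewrite (@eq_qconv _ _ _ (fun j k => (a - c * q ^+ n) * (u j * v k))).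
  by rewrite qconvZ; ring.
by move=> j k <-; rewrite exprD; ring.
Qed.

Lemma qquot_refl A a n : qquot A a A a n = (n == 0%N)%:R.
Proof.
elim/ltn_ind: n => -[//|n] IH; rewrite qquotS IH //.
case: n IH => [|n] IH; first by rewrite expr0 !mulr1 !subrr !mul0r subrr.
case: n IH => [|n] IH; last by rewrite !IH //= !mulr0 subr0.
by rewrite /= expr0 mulr0 !mulr1 subrr !mul0r subrr.
Qed.

Lemma qquotZ t A a B b n :
  qquot (t * A) (t ^+ 2 * a) (t * B) (t ^+ 2 * b) n = t ^+ n * qquot A a B b n.
Proof.
elim/ltn_ind: n => -[_|n IH]; first by rewrite expr0 mul1r.
rewrite !qquotS IH // exprS; case: n IH => [|n] IH.
  by rewrite /= !expr0; ring.
by rewrite IH /= ?exprS; [ring|exact: ltnW].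
Qed.

(* Multiplying the generating function by 1 - A t + a t^2. *)
Lemma qquot_shiftA A a B b n : qquot (q * A) (q ^+ 2 * a) B b n =
  qquot A a B b n - A * (1 - q ^+ n) * qquot A a B b n.-1
  + a * (1 - q ^+ n) * (1 - q ^+ n.-1) * qquot A a B b n.-2.
Proof.
elim/ltn_ind: n => -[_|[_|[_|[_|n IH]]]].
- by rewrite /= expr0; ring.
- by rewrite /= expr0 expr1; ring.
- by rewrite /= !expr0 !expr1; ring.
- by rewrite /= !expr0 !expr1; ring.
rewrite qquotS [qquot A a B b n.+4]qquotS !IH // !succnK.
have e m : qquot A a B b m.+2 = (A - B * q ^+ m.+1) * qquot A a B b m.+1
  - (a - b * q ^+ m) * (1 - q ^+ m.+1) * qquot A a B b m by [].
move: (e n) (e n.+1).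
set s0 := qquot A a B b n; set s1 := qquot A a B b n.+1.
set s2 := qquot A a B b n.+2; set s3 := qquot A a B b n.+3.
rewrite !exprS; move: s0 s1 s2 s3 (q ^+ n) => s0 s1 s2 s3 Q -> ->.
ring.
Qed.

(* Multiplying the generating function by 1 - B t + b t^2, after t := q t. *)
Lemma qquot_shiftB A a B b n : qquot (q * A) (q ^+ 2 * a) B b n =
  q ^+ n * qquot A a B b n - B * q ^+ n.-1 * (1 - q ^+ n) * qquot A a B b n.-1
  + b * q ^+ n.-2 * (1 - q ^+ n) * (1 - q ^+ n.-1) * qquot A a B b n.-2.
Proof.
rewrite qquot_shiftA; case: n => [|n]; first by rewrite /= !expr0; ring.
rewrite [qquot A a B b n.+1]qquotS /=; ring.
Qed.

End QQuotient.

Arguments qquot : simpl never.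

(** * The classical families as quotients *)

Section Families.
Variables (F : fieldType) (q : F).

Lemma qpoch0 (a : F) : qpoch a q 0 = 1.
Proof. by rewrite /qpoch big_ord0. Qed.

Lemma qpochS (a : F) n : qpoch a q n.+1 = qpoch a q n * (1 - a * q ^+ n).
Proof. by rewrite /qpoch big_ord_recr. Qed.

Lemma qpochD (a : F) m n :
  qpoch a q (m + n) = qpoch a q m * qpoch (a * q ^+ m) q n.
Proof.
elim: n => [|n IH]; first by rewrite addn0 qpoch0 mulr1.
by rewrite addnS !qpochS IH -!mulrA -exprD.
Qed.

Lemma qpochSl (a : F) n : qpoch a q n.+1 = (1 - a) * qpoch (a * q) q n.
Proof. by rewrite -add1n qpochD qpochS qpoch0 expr0 expr1 mul1r mulr1. Qed.

Lemma qpoch_neq0 (a : F) n :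
  (forall k, a * q ^+ k != 1) -> qpoch a q n != 0.
Proof.
by move=> h; apply/prodf_neq0 => i _; rewrite subr_eq0 eq_sym h.
Qed.

Lemma ASC_qquot (x y rho : F) n :
  ASC x y rho q n = qquot q (2 * x) 1 (2 * rho * y) (rho ^+ 2) n.
Proof.
elim/ltn_ind: n => -[//|[|n]] IH; first by rewrite /qquot /= expr0; ring.
rewrite qquotS -!IH // !succnK.
have -> : ASC x y rho q n.+2 = 2 * (x - rho * y * q ^+ n.+1) * ASC x y rho q n.+1
  - (1 - rho ^+ 2 * q ^+ n) * (1 - q ^+ n.+1) * ASC x y rho q n by [].
by ring.
Qed.

End Families.

(** At q = 0 the product is the single factor 1 - 2xt + t^2, whose coefficients are the tabulated
    values; for q != 0 the weight (-1)^n q^C(n,2) turns the recurrence in base 1/q into one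
    polynomial in q. *)
Lemma bpol_qquot (F : fieldType) (q x : F) n :
  bpol x q n = qquot q 0 0 (2 * x) 1 n.
Proof.
rewrite /bpol; case: eqP => [->|/eqP q0].
  elim/ltn_ind: n => -[//|[|[|[|n]]]] IH; try by rewrite /qquot /= ?expr0; ring.
  by rewrite qquotS -!IH // !succnK !exprS; case: n IH => [|n] _; ring.
elim/ltn_ind: n => -[_|[_|n IH]]; first by rewrite !expr0 !mulr1.
  by rewrite /qquot /= !expr0 expr1; ring.
rewrite qquotS -!IH // !succnK.
have C n' : 'C(n'.+1, 2) = (n' + 'C(n', 2))%N by rewrite binS bin1 addnC.
have -> : qHermite x q^-1 n.+2 = 2 * x * qHermite x q^-1 n.+1
  - (1 - q^-1 ^+ n.+1) * qHermite x q^-1 n by [].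
rewrite !C !exprD !exprS.
rewrite exprVn; have := expf_neq0 n q0.
move: (q ^+ n) (q ^+ 'C(n, 2)) (qHermite x q^-1 n.+1) (qHermite x q^-1 n).
by move=> Q C2 h1 h0 Q0; field; rewrite q0 Q0.
Qed.

(** Inverting rho and rescaling t by rho gives the p_n quotient in y and x the form of the
    reciprocal of the one in x and y; in this form rho = 0 is not exceptional. *)
Lemma gpol_qquot (F : fieldType) (q x y rho : F) n :
  gpol x y rho q n = qquot q (2 * rho * y) (rho ^+ 2) (2 * x) 1 n.
Proof.
rewrite /gpol; case: eqP => [-> //|_]; case: eqP => [->|/eqP r0].
  by rewrite bpol_qquot expr0n mulr0 mul0r.
rewrite ASC_qquot -qquotZ; congr qquot; first by ring.
- by rewrite mulr1.
- by field.
- by field.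
Qed.

(** * Orthogonality of the p_j and g_k under Pochhammer weights *)

Section Orthogonality.
Variables (F : fieldType) (q : F) (A B b : F).

Let u := qquot q A 1 B b.
Let v N := qquot q (q ^+ N * B) (q ^+ N ^+ 2 * b) A 1.

Let T N n := qconv q (fun j k => qpoch (b * q ^+ j) q N * u j * v N k) n.

Let vS N : v N.+1 =1 qquot q (q * (q ^+ N * B)) (q ^+ 2 * (q ^+ N ^+ 2 * b)) A 1.
Proof. by move=> k; rewrite /v exprS; congr qquot; ring. Qed.

Let T_rec N n : T N.+1 n.+2 = (1 - b * q ^+ (N + n.+2)) * T N n.+2
  + (b * A * q ^+ (N + n.+1) - q ^+ N * B) * (1 - q ^+ n.+2) * T N n.+1
  + b * q ^+ N * (q ^+ N - q ^+ n) * (1 - q ^+ n.+2) * (1 - q ^+ n.+1) * T N n.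
Proof.
pose w j k := qpoch (b * q ^+ j) q N * u j * v N k.
transitivity (qconv q (fun j k => (1 - b * q ^+ (N + n.+2)) * w j k +
   ((b * A * q ^+ (N + n.+1) - q ^+ N * B) * ((1 - q ^+ k) * w j k.-1) +
   (b * q ^+ N * (q ^+ N - q ^+ n)) *
       ((1 - q ^+ k) * ((1 - q ^+ k.-1) * w j k.-2)))) n.+2).
  apply: eq_qconv => j k jk; rewrite /w qpochS vS.
  set t := qpoch _ _ _; set s := qquot _ _ _ _ _.
  (* The two occurrences of [s k] are expanded differently, by [qquot_shiftA] and by [qquot_shiftB];
     the powers of q then combine so that every coefficient depends on j + k only. *)
  have -> : t * (1 - b * q ^+ j * q ^+ N) * u j * s k =
    t * u j * (s k - b * q ^+ j * q ^+ N * s k) by ring.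
  rewrite {1}/s qquot_shiftA {}/s qquot_shiftB -/(v N).
  rewrite -/(v N k) -/(v N k.-1) -/(v N k.-2) !exprD -jk.
  case: k jk => [|[|k]] jk /=.
  - by rewrite addn0 expr0; ring.
  - have -> : j = n.+1 by lia.
    by rewrite addn1 expr0 !exprS; ring.
  have -> : n = (j + k)%N by lia.
  by rewrite !addnS !exprS !exprD; ring.
rewrite !qconvD !qconvZ.
rewrite (qconv_shiftr q (fun j k => w j k)).
rewrite (qconv_shiftr q (fun j k => (1 - q ^+ k) * w j k.-1)).
rewrite (qconv_shiftr q (fun j k => w j k)).
by rewrite /T -/w; ring.
Qed.

(* Up to (q)_n, these sums are the coefficients of a polynomial in t of degree
   at most N. *)
Lemma qquot_orthogonal N n : (N < n)%N ->
  qconv q (fun j k => qpoch (b * q ^+ j) q N * qquot q A 1 B b j *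
    qquot q (q ^+ N * B) (q ^+ N ^+ 2 * b) A 1 k) n = 0.
Proof.
rewrite -/(T N n); elim: N n => [|N IH] n.
  rewrite /T => n0; rewrite (@eq_qconv _ _ _ (fun j k => u j * qquot q B b A 1 k)).
    by rewrite /u qquot_conv qquot_refl -[n]prednK.
  by move=> j k _; rewrite qpoch0 mul1r /v expr0 expr1n !mul1r.
case: n => [|[|n]] // ltNn; rewrite T_rec (IH n.+2) ?(IH n.+1); try by lia.
(* For n = N the induction hypothesis says nothing about T N n, but its coefficient contains q^N -
   q^n = 0. *)
case: (ltngtP N n) => [ltN|ltN|->]; first by rewrite IH //; ring.
  by lia.
by ring.
Qed.

End Orthogonality.

(** Both sides are the q-trinomial coefficient. Pascal's rule on both sides replaces the quotient of
    factorials, which is meaningless when some (q)_n vanishes. *)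
Lemma gbin_trinomial (F : fieldType) (q : F) k i e :
  gbin q (k + i + e) (k + i) * gbin q (k + i) k =
  gbin q (k + i + e) k * gbin q (i + e) i.
Proof.
elim: {k i e}(k + i + e)%N {-2}k {-2}i {-2}e (leqnn (k + i + e)) => [|s IH] k i e.
  by case: k i e => [|?] [|?] [|?] //=; rewrite !gbin0.
case: k => [|k]; first by rewrite !add0n !gbin0 mulr1 mul1r.
case: i => [|i]; first by rewrite !addn0 gbinn gbin0 mulr1.
case: e => [|e]; first by rewrite !addn0 !gbinn mulr1 mul1r.
move=> les.
have I1 := IH k i.+1 e.+1 ltac:(lia).
have I2 := IH k.+1 i e.+1 ltac:(lia).
have I3 := IH k.+1 i.+1 e ltac:(lia).
move: I1 I2 I3; rewrite !(addSn, addnS) => I1 I2 I3.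
rewrite [gbin q (k + i + e).+3 (k + i).+2]gbinS.
rewrite [gbin q (k + i + e).+3 k.+1]gbinS.
have -> : (gbin q (k + i + e).+2 (k + i).+1 +
     q ^+ (k + i).+2 * gbin q (k + i + e).+2 (k + i).+2) * gbin q (k + i).+2 k.+1 =
   gbin q (k + i + e).+2 (k + i).+1 * gbin q (k + i).+1 k +
   q ^+ k.+1 * (gbin q (k + i + e).+2 (k + i).+1 * gbin q (k + i).+1 k.+1) +
   q ^+ (k + i).+2 *
     (gbin q (k + i + e).+2 (k + i).+2 * gbin q (k + i).+2 k.+1).
  by rewrite mulrDl {1}[gbin q (k + i).+2 k.+1]gbinS; ring.
rewrite I1 I2 I3 [gbin q (i + e).+2 i.+1]gbinS.
have -> : q ^+ (k + i).+2 = q ^+ k.+1 * q ^+ i.+1 by rewrite -exprD addSn addnS.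
by ring.
Qed.

Lemma sum_ord_window (V : nmodType) (f : nat -> V) k d m :
  (k + d <= m)%N -> (forall j, (j < k)%N || (k + d < j)%N -> f j = 0) ->
  \sum_(j < m.+1) f j = \sum_(i < d.+1) f (k + i)%N.
Proof.
move=> le f0; rewrite -(big_mkord xpredT) (@big_cat_nat _ _ _ k) //=; last by lia.
rewrite big_nat_cond big1 ?add0r; last first.
  by move=> j /andP[/andP[_ jk] _]; rewrite f0 ?jk.
rewrite (@big_cat_nat _ _ _ (k + d.+1)) /=; [|by lia|by lia].
rewrite [X in _ + X]big_nat_cond [X in _ + X]big1 ?addr0; last first.
  by move=> j /andP[/andP[jk _] _]; rewrite f0 // -addnS jk orbT.
rewrite -{1}[k]add0n big_addn addKn big_mkord.
by apply: eq_bigr => i _; rewrite addnC.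
Qed.

(** * The inverse pair of triangular matrices *)

Section InversePair.
Variables (F : fieldType) (q A B b : F).
Hypothesis b_neq : forall k, b * q ^+ k != 1.

Let p N := qquot q A 1 (q ^+ N * B) (q ^+ N ^+ 2 * b).
Let g N := qquot q (q ^+ N * B) (q ^+ N ^+ 2 * b) A 1.

(** For A = 2z, B = 2 rho1 rho2 y and b = (rho1 rho2)^2 these are the coefficients of alpha_n in the
    p_j, up to the factor rho2^(n-j) (rho1^2 q^j)_(n-j). The truncated exponents only matter at n =
    j = 0, where the Pochhammer symbol is empty. *)
Definition asc_to_aw n j : F :=
  gbin q n j * g n.-1 (n - j) / qpoch (b * q ^+ (n + j).-1) q (n - j).

Definition aw_to_asc n j : F :=
  gbin q n j * p j (n - j) / qpoch (b * q ^+ (2 * j)) q (n - j).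

Let nz m n : qpoch (b * q ^+ m) q n != 0.
Proof. by apply: qpoch_neq0 => k; rewrite -mulrA -exprD. Qed.

(** With n - k = d + 1, the common denominator (b q^(2k))_(2d+1) splits into the two denominators
    and a middle block of length d. That block is the weight in [qquot_orthogonal] with N = d, one
    less than the degree, so the sum vanishes. *)
Lemma asc_to_awK m n k : (n <= m)%N -> (k <= m)%N ->
  \sum_(j < m.+1) asc_to_aw n j * aw_to_asc j k = (n == k)%:R.
Proof.
move=> lenm lekm; case: (ltnP n k) => [ltnk|lekn].
  rewrite (ltn_eqF ltnk) big1 // => j _; rewrite /asc_to_aw /aw_to_asc.
  case: (ltnP n j) => [ltnj|lejn]; first by rewrite gbin_small // !mul0r.
  by rewrite (@gbin_small _ _ j) ?(leq_ltn_trans lejn) // !(mul0r, mulr0).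
pose d := (n - k)%N; have def_n : n = (k + d)%N by rewrite subnKC.
rewrite (@sum_ord_window _ (fun j => asc_to_aw n j * aw_to_asc j k) k d).
- rewrite /asc_to_aw /aw_to_asc def_n -[X in _ == X]addn0 eqn_add2l.
  case: d def_n => [|d] def_n.
    rewrite big_ord1 addn0 subnn !qpoch0 !gbinn /p /g /qquot.
    by rewrite !mulr1 !invr1 !mulr1.
  have h i : (i <= d.+1)%N -> qpoch (b * q ^+ (2 * k)) q (d.+1 + d) =
    qpoch (b * q ^+ (2 * k)) q i * qpoch (b * q ^+ (2 * k) * q ^+ i) q d *
    qpoch (b * q ^+ (k + d.+1 + (k + i)).-1) q (d.+1 - i).
    move=> lei; have -> : (d.+1 + d = (i + d) + (d.+1 - i))%N by lia.
    rewrite !qpochD; congr (_ * qpoch _ q _); rewrite -mulrA -exprD; congr (_ * _ ^+ _).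
    by lia.
  transitivity (gbin q (k + d.+1) k / qpoch (b * q ^+ (2 * k)) q (d.+1 + d) *
    qconv q (fun i e => qpoch (b * q ^+ (2 * k) * q ^+ i) q d *
     qquot q A 1 (q ^+ k * B) (q ^+ k ^+ 2 * b) i *
     qquot q (q ^+ d * (q ^+ k * B)) (q ^+ d ^+ 2 * (q ^+ k ^+ 2 * b)) A 1 e) d.+1).
    rewrite /qconv mulr_sumr; apply: eq_bigr => i _.
    have lei : (i <= d.+1)%N by rewrite -ltnS.
    have := h i lei; have := gbin_trinomial q k i (d.+1 - i).
    rewrite -addnA !subnKC // addKn subnDl.
    rewrite /p /g.
    have -> : (k + d.+1).-1 = (d + k)%N by rewrite addnS addnC.
    rewrite exprD exprMn -!mulrA.
    have := nz (2 * k) i; have := nz (2 * k + i) d.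
    have := nz (k + d.+1 + (k + i)).-1 (d.+1 - i).
    rewrite exprD.
    set x1 := qpoch _ _ _; set x2 := qpoch _ _ _; set x3 := qpoch _ _ _.
    set x4 := qpoch _ _ (_ + _); set y1 := qquot _ _ _ _ _ _.
    set y2 := qquot _ _ _ _ _ _.
    set g1 := gbin _ _ _; set g2 := gbin _ _ _; set g3 := gbin _ _ _.
    set g4 := gbin _ _ _.
    move: x1 x2 x3 x4 y1 y2 g1 g2 g3 g4 => x1 x2 x3 x4 y1 y2 g1 g2 g3 g4.
    move=> h1 h2 h3 eg ->.
    have -> : g1 * (y1 * (x1^-1 * (g2 * (y2 * x3^-1)))) =
       (g1 * g2) * (y1 * (x1^-1 * (y2 * x3^-1))) by ring.
    by rewrite eg; field; rewrite h1 h2 h3.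
  have -> : b * q ^+ (2 * k) = q ^+ k ^+ 2 * b by rewrite mulrC exprM exprAC.
  by rewrite qquot_orthogonal ?mulr0.
- by rewrite -def_n.
- move=> j /orP[jk|nj]; rewrite /asc_to_aw /aw_to_asc.
    by rewrite (@gbin_small _ _ j) // !(mul0r, mulr0).
  by rewrite (@gbin_small _ _ n) ?def_n // !mul0r.
Qed.

(** The entries with indices at most n form square matrices, for which a right inverse is a left
    inverse. *)
Lemma aw_to_ascK n k : (k <= n)%N ->
  \sum_(j < n.+1) aw_to_asc n j * asc_to_aw j k = (n == k)%:R.
Proof.
move=> lekn.
pose M := \matrix_(i < n.+1, j < n.+1) asc_to_aw i j.
pose M' := \matrix_(i < n.+1, j < n.+1) aw_to_asc i j.
have MM' : M *m M' = 1%:M.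
  apply/matrixP => i j; rewrite !mxE -(@asc_to_awK n) ?leq_ord //.
  by apply: eq_bigr => l _; rewrite !mxE.
have := mulmx1C MM' => /matrixP /(_ ord_max (Ordinal (lekn : k < n.+1)%N)).
by rewrite !mxE => <-; apply: eq_bigr => l _; rewrite !mxE.
Qed.

End InversePair.

(** * The finite identities of (i) *)

Section FiniteIdentities.
Variables (F : fieldType) (q : F).
Hypothesis hq : (forall m, (0 < m)%N -> q ^+ m != 1) \/ q = 1.

Lemma sum_ASC_gpol n (z y beta : F) : (0 < n)%N ->
  \sum_(j < n.+1) qbinom q n j * qpoch (beta ^+ 2 * q ^+ j) q n.-1
    * ASC z y beta q j * gpol z y (beta * q ^+ n.-1) q (n - j) = 0.
Proof.
move=> n0; have ltn : (n.-1 < n)%N by rewrite prednK.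
rewrite -[RHS](qquot_orthogonal q (2 * z) (2 * beta * y) (beta ^+ 2) ltn).
apply: eq_bigr => j _; rewrite gbin_qbinom ?leq_ord // ASC_qquot gpol_qquot.
rewrite -!mulrA; congr (_ * (_ * (_ * _))).
by congr qquot; ring.
Qed.

(** This is the entry (n, 0) of [aw_to_ascK]. The term j = 0, where the uniform formula would
    involve beta^2 q^(-1), is written after cancellation. *)
Lemma sum_ASC_gpol_dual n (z y beta : F) : (0 < n)%N ->
  (forall k, beta ^+ 2 * q ^+ k != 1) ->
  \sum_(j < n.+1) qbinom q n j
    * (if j == 0%N :> nat then
         ASC z y beta q n
         / (qpoch (beta ^+ 2) q n.-1 * (1 - beta ^+ 2 * q ^+ n.-1))
       else
         ASC z y (beta * q ^+ j) q (n - j) * gpol z y (beta * q ^+ j.-1) q j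
         * (1 - beta ^+ 2 * q ^+ (2 * j).-1)
         / (qpoch (beta ^+ 2 * q ^+ j.-1) q n
            * (1 - beta ^+ 2 * q ^+ (n + j).-1))) = 0.
Proof.
move=> n0 hb; have := aw_to_ascK (2 * z) (2 * beta * y) hb (leq0n n).
rewrite (gtn_eqF n0) => e; apply: etrans e.
apply: eq_bigr => j _; have lejn := leq_ord j.
rewrite gbin_qbinom // /aw_to_asc /asc_to_aw gbin0 mul1r subn0 addn0.
rewrite -!mulrA; congr (_ * _); case: eqP => [j0|/eqP jN0].
  rewrite j0 !subn0 qpoch0 /= invr1 !mulr1 mulrA; congr (_ * _).
    by rewrite ASC_qquot; congr qquot; ring.
  by rewrite -qpochS prednK.
rewrite ASC_qquot gpol_qquot.
have -> : 2 * (beta * q ^+ j) * y = q ^+ j * (2 * (beta * y)) by ring.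
have -> : 2 * (beta * q ^+ j.-1) * y = q ^+ j.-1 * (2 * (beta * y)) by ring.
have -> : (beta * q ^+ j) ^+ 2 = q ^+ j * (q ^+ j * beta ^+ 2) by ring.
have -> : (beta * q ^+ j.-1) ^+ 2 = q ^+ j.-1 * (q ^+ j.-1 * beta ^+ 2) by ring.
congr (_ * _); rewrite [RHS]mulrCA; congr (_ * _).
have nz m r : qpoch (beta ^+ 2 * q ^+ m) q r != 0.
  by apply: qpoch_neq0 => k; rewrite -mulrA -exprD.
(* The n + 1 factors starting at q^(i-1) are regrouped as i, 1 and n - i; the single one is
   cancelled by the numerator and the others are the denominators of the two matrices. *)
have h i : (0 < i <= n)%N ->
  qpoch (beta ^+ 2 * q ^+ i.-1) q n * (1 - beta ^+ 2 * q ^+ (n + i).-1)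
  = qpoch (beta ^+ 2 * q ^+ i.-1) q i * (1 - beta ^+ 2 * q ^+ (2 * i).-1)
    * qpoch (beta ^+ 2 * q ^+ (2 * i)) q (n - i).
  move=> lein; have -> : (n + i).-1 = (i.-1 + n)%N by lia.
  rewrite exprD mulrA -qpochS; have -> : n.+1 = ((i + 1) + (n - i))%N by lia.
  rewrite qpochD addn1 qpochS -!mulrA -!exprD.
  have -> : (i.-1 + i = (2 * i).-1)%N by lia.
  by have -> : (i.-1 + i.+1 = 2 * i)%N by lia.
have hj := hb (2 * j).-1; rewrite -subr_eq0 -opprB oppr_eq0 in hj.
have bb t : beta * (beta * t) = beta ^+ 2 * t by ring.
rewrite !bb h ?lt0n ?jN0 //; have := nz j.-1 j; have := nz (2 * j)%N (n - j)%N.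
by move: hj (qpoch _ _ _) (qpoch _ _ _) => hj P1 P2 h1 h2; field; rewrite h1 h2 hj.
Qed.

(** The signed weights make this an n-th q-difference, and each difference of (beta q^j)_N lowers N
    by one and replaces beta by beta q. The direct proof keeps the base q: at z = y = 0 the
    polynomials of odd index vanish and those of even index factor over the base q^2. *)
Lemma qconv_sign_qpoch N n (beta : F) : (N < n)%N ->
  qconv q (fun k j => (-1) ^+ k * q ^+ 'C(k, 2) * qpoch (beta * q ^+ j) q N) n = 0.
Proof.
have C k : 'C(k.+1, 2) = (k + 'C(k, 2))%N by rewrite binS bin1 addnC.
elim: N n beta => [|N IH] [|n] beta // ltNn; rewrite qconvS.
  rewrite (@eq_qconv _ _ _ (fun _ _ => 0 * 0)); first by rewrite qconvZ mul0r.
  by move=> k j _; rewrite !qpoch0 C exprD exprS; ring.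
rewrite (@eq_qconv _ _ _ (fun k j => (beta * q ^+ n * (1 - q ^+ N.+1)) *
   ((-1) ^+ k * q ^+ 'C(k, 2) * qpoch (beta * q * q ^+ j) q N))).
  by rewrite qconvZ IH // mulr0.
move=> k j <-; rewrite qpochSl qpochS C !exprD !exprS.
have -> : beta * (q * q ^+ j) = beta * q * q ^+ j by ring.
have -> : beta * q ^+ j * q = beta * q * q ^+ j by ring.
by ring.
Qed.

Lemma sum_sign_qpoch n (beta : F) : (0 < n)%N ->
  \sum_(k < n.+1) (-1) ^+ k * q ^+ 'C(k, 2) * qbinom q n k
     * qpoch (beta * q ^+ (n - k)) q n.-1 = 0.
Proof.
move=> n0; have ltn : (n.-1 < n)%N by rewrite prednK.
rewrite -[RHS](qconv_sign_qpoch beta ltn); apply: eq_bigr => k _.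
by rewrite gbin_qbinom ?leq_ord //; ring.
Qed.

(** The sum telescopes: its partial sums have the closed form [S], whose Gaussian binomial vanishes
    at the last index. *)
Lemma sum_sign_qpochV n (beta : F) : (0 < n)%N ->
  (forall k, beta * q ^+ k != 1) ->
  \sum_(k < n.+1) (-1) ^+ k * q ^+ 'C(k, 2) * qbinom q n k
     * ((1 - beta * q ^+ (2 * k)) / qpoch (beta * q ^+ k) q n.+1) = 0.
Proof.
case: n => // n _ hb.
have C k : 'C(k.+1, 2) = (k + 'C(k, 2))%N by rewrite binS bin1 addnC.
have nz m r : qpoch (beta * q ^+ m) q r != 0.
  by apply: qpoch_neq0 => k; rewrite -mulrA -exprD.
have h1 m : 1 - beta * q ^+ m != 0 by rewrite subr_eq0 eq_sym hb.
have S m : (m <= n.+1)%N ->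
  \sum_(k < m.+1) (-1) ^+ k * q ^+ 'C(k, 2) * qbinom q n.+1 k
     * ((1 - beta * q ^+ (2 * k)) / qpoch (beta * q ^+ k) q n.+2) =
  (-1) ^+ m * q ^+ 'C(m.+1, 2) * gbin q n m / qpoch (beta * q ^+ m.+1) q n.+1.
  elim: m => [|m IH] lemn.
    rewrite big_ord1 gbin_qbinom // !gbin0 qpochSl !expr0 !mulr1 !mul1r expr1.
    have := h1 0%N; have := nz 1%N n.+1; rewrite expr0 expr1 mulr1.
    by move: (qpoch _ _ _) => P hP hb1; field; rewrite hP hb1.
  rewrite big_ord_recr /= IH ?(ltnW lemn) // gbin_qbinom //.
  have e1 : qpoch (beta * q ^+ m.+1) q n.+2 = (1 - beta * q ^+ m.+1) *
     (qpoch (beta * q ^+ m.+2) q n * (1 - beta * q ^+ (m + n.+2))).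
    rewrite qpochSl -mulrA -exprSr qpochS -[beta * _ * _]mulrA -exprD.
    by rewrite !addSn !addnS.
  have e2 : qpoch (beta * q ^+ m.+1) q n.+1 = (1 - beta * q ^+ m.+1) *
     qpoch (beta * q ^+ m.+2) q n by rewrite qpochSl -mulrA -exprSr.
  have e3 : qpoch (beta * q ^+ m.+2) q n.+1 =
     qpoch (beta * q ^+ m.+2) q n * (1 - beta * q ^+ (m + n.+2)).
    by rewrite qpochS -mulrA -exprD !addSn !addnS.
  rewrite e1 e2 e3 (C m.+1).
  have := gbinS_dual q (lemn : (m <= n)%N); rewrite gbinS => e.
  have := nz m.+2 n; have := h1 m.+1; have := h1 (m + n.+2)%N.
  have -> : q ^+ (m + n.+2) = q ^+ m.+1 * (q ^+ m.+1 * q ^+ (n - m)).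
    by rewrite -!exprD; congr (_ ^+ _); lia.
  have -> : q ^+ (2 * m.+1) = q ^+ m.+1 * q ^+ m.+1.
    by rewrite -!exprD; congr (_ ^+ _); lia.
  rewrite [q ^+ (m.+1 + _)]exprD [(-1) ^+ m.+1]exprS.
  move: e; move: (gbin q n m) (gbin q n m.+1) ((-1) ^+ m) (q ^+ 'C(m.+1, 2)).
  move: (q ^+ m.+1) (q ^+ (n - m)) (qpoch (beta * q ^+ m.+2) q n).
  move=> Q P D g g' sg c e d0 c0 D0.
  rewrite -[RHS]addr0.
  (* The two sides differ by a multiple of the discrepancy between the two Pascal rules, which is 0
     by [e]; spelling out the multiple leaves a rational identity. *)
  have <- : sg * c * beta * Q * Q / ((1 - beta * Q) * D *
     (1 - beta * (Q * (Q * P)))) * ((g + Q * g') - (P * g + g')) = 0.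
    by rewrite e subrr mulr0.
  by field; rewrite D0 c0 d0.
by rewrite S // gbin_small // mulr0 mul0r.
Qed.

End FiniteIdentities.

(** * Askey-Wilson coefficients, symmetry and inversion *)

Section AWCoefficients.
Variables (F : fieldType) (q : F).

Definition AWcoef (y rho1 z rho2 : F) m j : F :=
  gbin q m j
  * (rho2 ^+ (m - j) * qpoch (rho1 ^+ 2 * q ^+ j) q (m - j)
     / qpoch (rho1 ^+ 2 * rho2 ^+ 2 * q ^+ (m + j).-1) q (m - j))
  * gpol z y (rho1 * rho2 * q ^+ m.-1) q (m - j).

Lemma AWcoef_small y rho1 z rho2 m j : (m < j)%N -> AWcoef y rho1 z rho2 m j = 0.
Proof. by move=> ltmj; rewrite /AWcoef gbin_small // !mul0r. Qed.

Lemma AWcoef_diag y rho1 z rho2 m : AWcoef y rho1 z rho2 m m = 1.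
Proof.
by rewrite /AWcoef gbinn subnn !qpoch0 expr0 invr1 !mulr1.
Qed.

(** For the Askey-Wilson eigenvalue l_n = q^(-n) (1 - q^n) (1 - b q^(n-1)) this is q^m (l_m - l_j);
    the factor q^m removes negative powers, so that q = 0 is allowed. *)
Definition AWeig (b : F) m j := (1 - q ^+ (m - j)) * (1 - b * q ^+ (m + j).-1).

Definition AWlow1 (y rho1 z rho2 : F) m j :=
  (1 - q ^+ j) * (1 - rho1 ^+ 2 * q ^+ j.-1)
  * (2 * rho2 * (rho1 * rho2 * q ^+ m.-1 * y - z * q ^+ (m - j))).

Definition AWlow2 (rho1 rho2 : F) m j :=
  (1 - q ^+ j) * (1 - q ^+ j.-1) * (1 - rho1 ^+ 2 * q ^+ j.-1)
  * (1 - rho1 ^+ 2 * q ^+ j.-2) * rho2 ^+ 2 * q ^+ (m - j).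

(* In the basis p_j(x|y,rho1) the Askey-Wilson q-difference operator has three
   diagonals, with entries AWeig, AWlow1 and AWlow2 after normalisation, and
   alpha_m is its eigenvector with leading coefficient 1.  ASCcoef, the matrix of
   the p_i(x|z,rho2) in the basis p_j(x|y,rho1), intertwines the two forms of the
   operator, whence the symmetry of alpha_m in (y,rho1) and (z,rho2). *)
Lemma AWcoef_rec y rho1 z rho2 m j : (j < m)%N ->
  (forall k, rho1 ^+ 2 * rho2 ^+ 2 * q ^+ k != 1) ->
  AWeig (rho1 ^+ 2 * rho2 ^+ 2) m j * AWcoef y rho1 z rho2 m j =
  AWlow1 y rho1 z rho2 m j.+1 * AWcoef y rho1 z rho2 m j.+1 +
  AWlow2 rho1 rho2 m j.+2 * AWcoef y rho1 z rho2 m j.+2.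
Proof.
move=> ltjm hb; pose n := (m - j.+1)%N.
have def_m : m = (j + n.+1)%N by rewrite /n; lia.
have nz i r : qpoch (rho1 ^+ 2 * rho2 ^+ 2 * q ^+ i) q r != 0.
  by apply: qpoch_neq0 => k; rewrite -mulrA -exprD.
have nb i : 1 - rho1 ^+ 2 * rho2 ^+ 2 * q ^+ i != 0.
  by rewrite subr_eq0 eq_sym hb.
rewrite /AWeig /AWlow1 /AWlow2 /AWcoef !gpol_qquot !succnK.
set b := rho1 ^+ 2 * rho2 ^+ 2.
set g := qquot _ _ _ _ _.
have -> : (m - j = n.+1)%N by lia.
have -> : (m - j.+1 = n)%N by lia.
have -> : (m - j.+2 = n.-1)%N by lia.
have -> : (m + j).-1 = (2 * j + n)%N by lia.
have -> : (m + j.+1).-1 = (2 * j + n).+1%N by lia.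
have -> : (m + j.+2).-1 = (2 * j + n).+2%N by lia.
(* In the recurrence of g, the difference b q^(2m-2) - q^(n-1) is factored using m = j + n + 1; the
   resulting factor cancels the first factor of the denominator. *)
have G : g n.+1 = (2 * (rho1 * rho2 * q ^+ m.-1) * y - 2 * z * q ^+ n) * g n
   + q ^+ n.-1 * (1 - b * q ^+ (2 * j + n).+1) * (1 - q ^+ n) * g n.-1.
  rewrite {1}/g qquotS -/(g n) -/(g n.-1).
  case: n def_m => [|n] def_m; first by rewrite expr0; ring.
  have -> : q ^+ m.-1 = q ^+ j * (q * q ^+ n).
    by rewrite -exprS -exprD; congr (_ ^+ _); lia.
  have -> : q ^+ (2 * j + n.+1).+1 = q ^+ j * q ^+ j * (q * (q * q ^+ n)).
    by rewrite -!exprS -!exprD; congr (_ ^+ _); lia.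
  by rewrite succnK /b !exprS; ring.
have eX : qpoch (rho1 ^+ 2 * q ^+ j) q n.+1 =
  (1 - rho1 ^+ 2 * q ^+ j) * qpoch (rho1 ^+ 2 * q ^+ j.+1) q n.
  by rewrite qpochSl -mulrA -exprSr.
have eD : qpoch (b * q ^+ (2 * j + n)) q n.+1 =
  (1 - b * q ^+ (2 * j + n)) * qpoch (b * q ^+ (2 * j + n).+1) q n.
  by rewrite qpochSl -mulrA -exprSr.
have gb1 : (1 - q ^+ j.+1) * gbin q m j.+1 = (1 - q ^+ n.+1) * gbin q m j.
  by rewrite gbin_mulr; [congr ((1 - _ ^+ _) * _); lia|exact: ltnW].
have D0 : qpoch (b * q ^+ (2 * j + n).+1) q n != 0 by exact: nz.
have c0 : 1 - b * q ^+ (2 * j + n) != 0 by exact: nb.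
transitivity ((1 - q ^+ j.+1) * gbin q m j.+1 * rho2 ^+ n * rho2 *
   (1 - rho1 ^+ 2 * q ^+ j) * qpoch (rho1 ^+ 2 * q ^+ j.+1) q n /
   qpoch (b * q ^+ (2 * j + n).+1) q n * g n.+1).
  rewrite gb1 eX eD [rho2 ^+ n.+1]exprSr.
  by field; rewrite c0 D0.
rewrite G [in LHS]mulrDr; congr (_ + _).
  by field.
case: n {G eX eD gb1 c0} D0 def_m => [|n] D0 def_m.
  by rewrite (@gbin_small _ _ m j.+2) ?subrr ?mulr0 ?mul0r ?expr0 ?subrr; [ring|lia].
rewrite !succnK.
have eX : qpoch (rho1 ^+ 2 * q ^+ j.+1) q n.+1 =
  (1 - rho1 ^+ 2 * q ^+ j.+1) * qpoch (rho1 ^+ 2 * q ^+ j.+2) q n.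
  by rewrite qpochSl -mulrA -exprSr.
have eD : qpoch (b * q ^+ (2 * j + n.+1).+1) q n.+1 =
  (1 - b * q ^+ (2 * j + n.+1).+1) * qpoch (b * q ^+ (2 * j + n.+1).+2) q n.
  by rewrite qpochSl -mulrA -exprSr.
have gb2 : (1 - q ^+ j.+2) * gbin q m j.+2 = (1 - q ^+ n.+1) * gbin q m j.+1.
  by rewrite gbin_mulr; [congr ((1 - _ ^+ _) * _); lia|lia].
have c0 : 1 - b * q ^+ (2 * j + n.+1).+1 != 0 by exact: nb.
have D1 : qpoch (b * q ^+ (2 * j + n.+1).+2) q n != 0 by exact: nz.
transitivity ((1 - q ^+ j.+2) * gbin q m j.+2 * ((1 - q ^+ j.+1) *
  (1 - rho1 ^+ 2 * q ^+ j.+1) * (1 - rho1 ^+ 2 * q ^+ j) * rho2 ^+ 2 * q ^+ n *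
  (rho2 ^+ n * qpoch (rho1 ^+ 2 * q ^+ j.+2) q n /
    qpoch (b * q ^+ (2 * j + n.+1).+2) q n) * g n)); last by ring.
rewrite gb2 eX eD [rho2 ^+ n.+1]exprSr.
by field; rewrite c0 D1.
Qed.

Definition ASCcoef (y rho1 z rho2 : F) i j :=
  gbin q i j * qquot q (2 * rho1 * y) (rho1 ^+ 2) (2 * rho2 * z) (rho2 ^+ 2) (i - j).

(** The difference of the two [AWeig] is q^m (l_i - l_j), the diagonals of both forms collected on
    one side. For i = j + k + 1 everything has the common factor (1 - q^(k+1)) [gbin q i j], and
    what remains is the recurrence for the coefficient of index k + 1. *)
Lemma ASCcoef_intertwine y rho1 z rho2 m i j : (i <= m)%N -> (j <= m)%N ->
  AWlow1 z rho2 y rho1 m i * ASCcoef y rho1 z rho2 i.-1 j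
  + AWlow2 rho2 rho1 m i * ASCcoef y rho1 z rho2 i.-2 j
  + (AWeig (rho1 ^+ 2 * rho2 ^+ 2) m j - AWeig (rho1 ^+ 2 * rho2 ^+ 2) m i)
    * ASCcoef y rho1 z rho2 i j =
  AWlow1 y rho1 z rho2 m j.+1 * ASCcoef y rho1 z rho2 i j.+1
  + AWlow2 rho1 rho2 m j.+2 * ASCcoef y rho1 z rho2 i j.+2.
Proof.
move=> leim lejm; case: (ltnP i j) => [ltij|leji].
  rewrite /ASCcoef !gbin_small; try by lia.
  by ring.
case: (eqVneq i j) => [->|neij].
  rewrite subrr /ASCcoef.
  case: j {leji lejm} => [|j].
    by rewrite /AWlow1 /AWlow2 expr0 (@gbin_small _ _ 0 1) // (@gbin_small _ _ 0 2) //; ring.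
  rewrite (@gbin_small _ _ j.+1 j.+2) // (@gbin_small _ _ j.+1 j.+3) //.
  rewrite (@gbin_small _ _ _ j.+1) // (@gbin_small _ _ _ j.+1) ?ltnS ?leq_pred //.
  by ring.
pose k := (i - j).-1; have def_i : i = (j + k.+1)%N by rewrite /k; lia.
pose r := qquot q (2 * rho1 * y) (rho1 ^+ 2) (2 * rho2 * z) (rho2 ^+ 2).
have g1 : (1 - q ^+ i) * gbin q i.-1 j = (1 - q ^+ k.+1) * gbin q i j.
  have -> : i = i.-1.+1 by lia.
  by rewrite succnK -gbin_mulSr; [rewrite mulrC; congr ((1 - _ ^+ _) * _); lia|lia].
have g2 : (1 - q ^+ j.+1) * gbin q i j.+1 = (1 - q ^+ k.+1) * gbin q i j.
  by rewrite gbin_mulr //; congr ((1 - _ ^+ _) * _); lia.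
have g3 : (1 - q ^+ i.-1) * gbin q i.-2 j = (1 - q ^+ k) * gbin q i.-1 j.
  case: k def_i {g2 g1} => [|k] def_i.
    rewrite expr0 subrr mul0r; case: j def_i {leji lejm neij} => [|j] def_i.
      by rewrite def_i expr0 subrr mul0r.
    by rewrite gbin_small ?mulr0 //; lia.
  have -> : i.-1 = i.-2.+1 by lia.
  by rewrite -gbin_mulSr; [rewrite mulrC; congr ((1 - _ ^+ _) * _); lia|lia].
have g4 : (1 - q ^+ j.+2) * gbin q i j.+2 = (1 - q ^+ k) * gbin q i j.+1.
  by rewrite gbin_mulr; [congr ((1 - _ ^+ _) * _); lia|lia].
have rS : r k.+1 = (2 * rho1 * y - 2 * rho2 * z * q ^+ k) * r k
    - (rho1 ^+ 2 - rho2 ^+ 2 * q ^+ k.-1) * (1 - q ^+ k) * r k.-1.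
  exact: qquotS.
rewrite /ASCcoef -/r /AWlow1 /AWlow2 !succnK.
have -> : (i - j = k.+1)%N by lia.
have -> : (i.-1 - j = k)%N by lia.
have -> : (i.-2 - j = k.-1)%N by lia.
have -> : (i - j.+1 = k)%N by lia.
have -> : (i - j.+2 = k.-1)%N by lia.
transitivity (((1 - q ^+ k.+1) * gbin q i j) * (
   (1 - rho2 ^+ 2 * q ^+ i.-1) *
     (2 * rho1 * (rho2 * rho1 * q ^+ m.-1 * z - y * q ^+ (m - i))) * r k
   + (1 - q ^+ k) * ((1 - rho2 ^+ 2 * q ^+ i.-1) * (1 - rho2 ^+ 2 * q ^+ i.-2)
       * rho1 ^+ 2 * q ^+ (m - i)) * r k.-1
   + (q ^+ (m - i) - rho1 ^+ 2 * rho2 ^+ 2 * q ^+ (m + j).-1) * r k.+1)).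
  have -> : AWeig (rho1 ^+ 2 * rho2 ^+ 2) m j - AWeig (rho1 ^+ 2 * rho2 ^+ 2) m i =
    (1 - q ^+ k.+1) * (q ^+ (m - i) - rho1 ^+ 2 * rho2 ^+ 2 * q ^+ (m + j).-1).
    rewrite /AWeig; have -> : q ^+ (m - j) = q ^+ k.+1 * q ^+ (m - i).
      by rewrite -exprD; congr (_ ^+ _); lia.
    have -> : q ^+ (m + i).-1 = q ^+ k.+1 * q ^+ (m + j).-1.
      by rewrite -exprD; congr (_ ^+ _); lia.
    by ring.
  rewrite -[in RHS]g1 [RHS]mulrDr [X in _ = X + _]mulrDr;
  congr (_ + _ + _); [by ring| |by rewrite g1; ring].
  transitivity ((1 - q ^+ i) * ((1 - q ^+ i.-1) * gbin q i.-2 j) * (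
     (1 - rho2 ^+ 2 * q ^+ i.-1) * (1 - rho2 ^+ 2 * q ^+ i.-2)
       * rho1 ^+ 2 * q ^+ (m - i)) * r k.-1); first by ring.
  by rewrite g3; ring.
transitivity (((1 - q ^+ k.+1) * gbin q i j) * (
   (1 - rho1 ^+ 2 * q ^+ j) *
     (2 * rho2 * (rho1 * rho2 * q ^+ m.-1 * y - z * q ^+ (m - j.+1))) * r k
   + (1 - q ^+ k) * ((1 - rho1 ^+ 2 * q ^+ j.+1) * (1 - rho1 ^+ 2 * q ^+ j)
       * rho2 ^+ 2 * q ^+ (m - j.+2)) * r k.-1)); last first.
  rewrite -[in LHS]g2 [LHS]mulrDr; congr (_ + _); first by ring.
  transitivity ((1 - q ^+ j.+1) * ((1 - q ^+ j.+2) * gbin q i j.+2) * (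
     (1 - rho1 ^+ 2 * q ^+ j.+1) * (1 - rho1 ^+ 2 * q ^+ j)
       * rho2 ^+ 2 * q ^+ (m - j.+2)) * r k.-1); last by ring.
  by rewrite g4; ring.
congr (_ * _); rewrite rS.
have -> : q ^+ i.-1 = q ^+ j * q ^+ k by rewrite -exprD; congr (_ ^+ _); lia.
have -> : q ^+ m.-1 = q ^+ (m - i) * q ^+ j * q ^+ k.
  by rewrite -!exprD; congr (_ ^+ _); lia.
have -> : q ^+ (m + j).-1 = q ^+ (m - i) * q ^+ j * q ^+ j * q ^+ k.
  by rewrite -!exprD; congr (_ ^+ _); lia.
have -> : q ^+ (m - j.+1) = q ^+ (m - i) * q ^+ k.
  by rewrite -!exprD; congr (_ ^+ _); lia.
case: k def_i {g1 g2 g3 g4 rS} => [|k] def_i; first by rewrite !expr0; ring.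
have -> : q ^+ i.-2 = q ^+ j * q ^+ k by rewrite -exprD; congr (_ ^+ _); lia.
have -> : q ^+ (m - j.+2) = q ^+ (m - i) * q ^+ k.
  by rewrite -!exprD; congr (_ ^+ _); lia.
by rewrite succnK !exprS; ring.
Qed.

(** By intertwining, the left side obeys the descending recurrence [AWcoef_rec] of the right side,
    and both equal 1 at j = m. Below m the factor [AWeig] is nonzero, so the recurrence determines
    all values. *)
Lemma AWcoef_connection y rho1 z rho2 m j : (j <= m)%N ->
  (forall k, (0 < k)%N -> q ^+ k != 1) ->
  (forall k, rho1 ^+ 2 * rho2 ^+ 2 * q ^+ k != 1) ->
  \sum_(i < m.+1) AWcoef z rho2 y rho1 m i * ASCcoef y rho1 z rho2 i j =
  AWcoef y rho1 z rho2 m j.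
Proof.
move=> lejm hq hb; pose C := AWcoef z rho2 y rho1 m.
pose Z j := \sum_(i < m.+1) C i * ASCcoef y rho1 z rho2 i j.
rewrite -/(Z j).
have hb' k : rho2 ^+ 2 * rho1 ^+ 2 * q ^+ k != 1 by rewrite [rho2 ^+ 2 * _]mulrC.
have Zrec l : (l <= m)%N -> AWeig (rho1 ^+ 2 * rho2 ^+ 2) m l * Z l =
    AWlow1 y rho1 z rho2 m l.+1 * Z l.+1 + AWlow2 rho1 rho2 m l.+2 * Z l.+2.
  move=> lelm; rewrite /Z !mulr_sumr -big_split /=.
  transitivity (\sum_(i < m.+1) C i * (AWlow1 z rho2 y rho1 m i * ASCcoef y rho1 z rho2 i.-1 l
     + AWlow2 rho2 rho1 m i * ASCcoef y rho1 z rho2 i.-2 l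
     + (AWeig (rho1 ^+ 2 * rho2 ^+ 2) m l - AWeig (rho1 ^+ 2 * rho2 ^+ 2) m i)
        * ASCcoef y rho1 z rho2 i l)); last first.
    by apply: eq_bigr => i _; rewrite ASCcoef_intertwine ?leq_ord //; ring.
  transitivity (\sum_(i < m.+1) (AWeig (rho1 ^+ 2 * rho2 ^+ 2) m i * C i
      * ASCcoef y rho1 z rho2 i l +
    C i * (AWeig (rho1 ^+ 2 * rho2 ^+ 2) m l - AWeig (rho1 ^+ 2 * rho2 ^+ 2) m i)
        * ASCcoef y rho1 z rho2 i l)).
    by apply: eq_bigr => i _; ring.
  rewrite big_split /= [RHS](eq_bigr (fun i : 'I_m.+1 =>
    C i * (AWlow1 z rho2 y rho1 m i * ASCcoef y rho1 z rho2 i.-1 l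
     + AWlow2 rho2 rho1 m i * ASCcoef y rho1 z rho2 i.-2 l) +
    C i * (AWeig (rho1 ^+ 2 * rho2 ^+ 2) m l - AWeig (rho1 ^+ 2 * rho2 ^+ 2) m i)
        * ASCcoef y rho1 z rho2 i l)); last by move=> i _; ring.
  rewrite big_split /=; congr (_ + _).
  transitivity (\sum_(i < m.+1) (AWlow1 z rho2 y rho1 m i.+1 * C i.+1 +
     AWlow2 rho2 rho1 m i.+2 * C i.+2) * ASCcoef y rho1 z rho2 i l).
    apply: eq_bigr => i _; congr (_ * _).
    case: (eqVneq (i : nat) m) => [->|neim].
      rewrite /C (@AWcoef_small _ _ _ _ m m.+1) // (@AWcoef_small _ _ _ _ m m.+2) //.
      by rewrite /AWeig subnn expr0; ring.
    rewrite /C -AWcoef_rec //; first by rewrite [rho2 ^+ 2 * _]mulrC.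
    by rewrite ltn_neqAle neim leq_ord.
  pose f i := AWlow1 z rho2 y rho1 m i * C i * ASCcoef y rho1 z rho2 i.-1 l.
  pose g i := AWlow2 rho2 rho1 m i * C i * ASCcoef y rho1 z rho2 i.-2 l.
  (* Shifting the summation index by one and two leaves boundary terms: those at 0 and 1 vanish with
     1 - q^0, those above m because [AWcoef] does. *)
  have f0 : f 0%N = 0 by rewrite /f /AWlow1 expr0; ring.
  have g0 : g 0%N = 0 by rewrite /g /AWlow2 expr0; ring.
  have g1 : g 1%N = 0 by rewrite /g /AWlow2 expr0; ring.
  transitivity (\sum_(i < m.+1) f i.+1 + \sum_(i < m.+1) g i.+2).
    by rewrite -big_split /=; apply: eq_bigr => i _; rewrite /f /g !succnK; ring.
  transitivity (\sum_(i < m.+1) f i + \sum_(i < m.+1) g i); last first.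
    by rewrite -big_split /=; apply: eq_bigr => i _; rewrite /f /g; ring.
  congr (_ + _).
    rewrite [RHS]big_ord_recl f0 add0r [LHS]big_ord_recr /= {2}/f /C.
    by rewrite AWcoef_small // mulr0 mul0r addr0.
  have gs i : (m < i)%N -> g i = 0.
    by move=> h; rewrite /g /C AWcoef_small // mulr0 mul0r.
  rewrite [RHS]big_ord_recl g0 add0r [LHS]big_ord_recr /= gs // addr0.
  case: (m) gs => [|m'] gs; first by rewrite !big_ord0.
  rewrite [RHS]big_ord_recl /= g1 add0r big_ord_recr /= gs // addr0.
  by apply: eq_bigr.
have main d : forall l, (m - l <= d)%N -> Z l = AWcoef y rho1 z rho2 m l.
  elim: d => [|d IH] l led.
    move: led; rewrite leqn0 subn_eq0 leq_eqVlt => /orP[/eqP <-|ltml].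
      rewrite AWcoef_diag /Z big_ord_recr /= big1 ?add0r.
        by rewrite /C AWcoef_diag /ASCcoef gbinn subnn !mulr1.
      by move=> i _; rewrite /ASCcoef gbin_small // mul0r mulr0.
    rewrite AWcoef_small // /Z big1 // => i _.
    by rewrite /ASCcoef gbin_small ?mul0r ?mulr0 // (leq_ltn_trans _ ltml) // leq_ord.
  case: (leqP m l) => [leml|ltlm].
    by apply: IH; move: leml; rewrite -subn_eq0 => /eqP ->.
  have eig0 : AWeig (rho1 ^+ 2 * rho2 ^+ 2) m l != 0.
    by rewrite mulf_neq0 // subr_eq0 eq_sym ?hb // hq // subn_gt0.
  apply: (mulfI eig0); rewrite Zrec ?(ltnW ltlm) // AWcoef_rec // !IH //; lia.
exact: main (leqnn _).
Qed.

Lemma AWalpha_AWcoef x y rho1 z rho2 m :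
  (forall k, (0 < k)%N -> q ^+ k != 1) ->
  AWalpha x y rho1 z rho2 q m =
  \sum_(j < m.+1) AWcoef y rho1 z rho2 m j * ASC x y rho1 q j.
Proof.
move=> hq; apply: eq_bigr => j _; rewrite /AWcoef gbin_qbinom ?leq_ord //.
by left.
Qed.

Lemma ASC_connection x y rho1 z rho2 n m : (n <= m)%N ->
  ASC x z rho2 q n = \sum_(j < m.+1) ASCcoef y rho1 z rho2 n j * ASC x y rho1 q j.
Proof.
move=> lenm; rewrite (@sum_ord_window _ (fun j => ASCcoef y rho1 z rho2 n j *
   ASC x y rho1 q j) 0 n) //; last first.
  by move=> j; rewrite add0n /= => ltnj; rewrite /ASCcoef gbin_small // !mul0r.
rewrite ASC_qquot -(qquot_conv q _ _ (2 * rho1 * y) (rho1 ^+ 2)).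
by apply: eq_bigr => j _; rewrite add0n ASC_qquot /ASCcoef; ring.
Qed.

Lemma AWalpha_sym x y rho1 z rho2 m :
  (forall k, (0 < k)%N -> q ^+ k != 1) ->
  (forall k, rho1 ^+ 2 * rho2 ^+ 2 * q ^+ k != 1) ->
  AWalpha x y rho1 z rho2 q m = AWalpha x z rho2 y rho1 q m.
Proof.
move=> hq hb; rewrite !AWalpha_AWcoef //.
transitivity (\sum_(i < m.+1) \sum_(j < m.+1)
   AWcoef z rho2 y rho1 m i * ASCcoef y rho1 z rho2 i j * ASC x y rho1 q j).
  rewrite exchange_big /=; apply: eq_bigr => j _.
  by rewrite -mulr_suml AWcoef_connection ?leq_ord.
apply: eq_bigr => i _; rewrite (@ASC_connection x y rho1 z rho2 i m) ?leq_ord //.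
by rewrite mulr_sumr; apply: eq_bigr => j _; rewrite mulrA.
Qed.

(** The weights w n m = rho2^(n-m) (rho1^2 q^m)_(n-m) satisfy w n m * w m j = w n j, so the inverse
    pair stays inverse when its entries are multiplied by them, even if rho2 = 0. *)
Lemma ASC_AWalpha x y rho1 z rho2 n :
  (forall k, (0 < k)%N -> q ^+ k != 1) ->
  (forall k, rho1 ^+ 2 * rho2 ^+ 2 * q ^+ k != 1) ->
  ASC x y rho1 q n = \sum_(m < n.+1) gbin q n m
    * (rho2 ^+ (n - m) * qpoch (rho1 ^+ 2 * q ^+ m) q (n - m)
       / qpoch (rho1 ^+ 2 * rho2 ^+ 2 * q ^+ (2 * m)) q (n - m))
    * ASC z y (rho1 * rho2 * q ^+ m) q (n - m) * AWalpha x y rho1 z rho2 q m.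
Proof.
move=> hq hb; pose b := rho1 ^+ 2 * rho2 ^+ 2.
pose P := aw_to_asc q (2 * z) (2 * (rho1 * rho2) * y) b.
pose Q := asc_to_aw q (2 * z) (2 * (rho1 * rho2) * y) b.
pose w m j := rho2 ^+ (m - j) * qpoch (rho1 ^+ 2 * q ^+ j) q (m - j).
have wM l m j : (j <= m <= l)%N -> w l m * w m j = w l j.
  move=> lejm; rewrite /w; have -> : (l - j = (m - j) + (l - m))%N by lia.
  rewrite qpochD exprD; have -> : rho1 ^+ 2 * q ^+ j * q ^+ (m - j) = rho1 ^+ 2 * q ^+ m.
    by rewrite -mulrA -exprD subnKC //; case/andP: lejm.
  by ring.
have Qw m j : AWcoef y rho1 z rho2 m j = Q m j * w m j.
  rewrite /AWcoef /Q /asc_to_aw /w gpol_qquot -/b.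
  have -> : 2 * (rho1 * rho2 * q ^+ m.-1) * y =
    q ^+ m.-1 * (2 * (rho1 * rho2) * y) by ring.
  have -> : (rho1 * rho2 * q ^+ m.-1) ^+ 2 = q ^+ m.-1 ^+ 2 * b by rewrite /b; ring.
  by ring.
have Pw m : gbin q n m * (rho2 ^+ (n - m) * qpoch (rho1 ^+ 2 * q ^+ m) q (n - m)
       / qpoch (rho1 ^+ 2 * rho2 ^+ 2 * q ^+ (2 * m)) q (n - m))
    * ASC z y (rho1 * rho2 * q ^+ m) q (n - m) = P n m * w n m.
  rewrite /P /aw_to_asc /w ASC_qquot -/b.
  have -> : 2 * (rho1 * rho2 * q ^+ m) * y =
    q ^+ m * (2 * (rho1 * rho2) * y) by ring.
  have -> : (rho1 * rho2 * q ^+ m) ^+ 2 = q ^+ m ^+ 2 * b by rewrite /b; ring.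
  by ring.
under eq_bigr => m _ do rewrite Pw AWalpha_AWcoef //.
transitivity (\sum_(m < n.+1) \sum_(j < n.+1)
   P n m * Q m j * (w n j * ASC x y rho1 q j)); last first.
  apply: eq_bigr => m _; rewrite mulr_sumr.
  rewrite (@sum_ord_window _ (fun j =>
     P n m * Q m j * (w n j * ASC x y rho1 q j)) 0 m) ?leq_ord //; last first.
    move=> j; rewrite add0n /= => ltmj.
    by rewrite /Q /asc_to_aw gbin_small // !(mul0r, mulr0).
  apply: eq_bigr => j _; rewrite add0n Qw -(wM n m j); first by ring.
  by rewrite !leq_ord.
rewrite exchange_big /=.
transitivity (\sum_(j < n.+1) (n == j)%:R * (w n j * ASC x y rho1 q j)); last first.
  by apply: eq_bigr => j _; rewrite -mulr_suml aw_to_ascK ?leq_ord.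
rewrite big_ord_recr /= eqxx mul1r /w subnn qpoch0 !mul1r big1 ?add0r //.
by move=> j _; rewrite gtn_eqF ?mul0r.
Qed.

End AWCoefficients.

(** * Convergent series and rearrangement of double series *)

Section HasSum.
Local Open Scope classical_set_scope.
Variable R : realType.
Implicit Types (u v : nat -> R) (l r : R).

Definition hassum u l := series u @ \oo --> l.

Lemma hassum_uniq u l l' : hassum u l -> hassum u l' -> l = l'.
Proof. exact: cvg_unique. Qed.

Lemma hassum_lim u l : hassum u l -> limn (series u) = l.
Proof. by move=> h; apply/cvg_lim. Qed.

Lemma eq_hassum u v l : u =1 v -> hassum u l -> hassum v l.
Proof. by move=> /funext ->. Qed.

Lemma hassumD u v l l' :
  hassum u l -> hassum v l' -> hassum (fun n => u n + v n) (l + l').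
Proof.
move=> hu hv; rewrite /hassum (_ : series _ = series u + series v).
  exact: cvgD.
by apply/funext => n; rewrite /series /= big_split.
Qed.

Lemma hassumZ c u l : hassum u l -> hassum (fun n => c * u n) (c * l).
Proof.
move=> hu; rewrite /hassum (_ : series _ = (fun n => c * series u n)).
  exact: cvgMl_tmp.
by apply/funext => n; rewrite /series /= mulr_sumr.
Qed.

Lemma hassum_shift u l :
  hassum u l -> hassum (fun n => if n is m.+1 then u m else 0) l.
Proof.
move=> hu; rewrite /hassum -cvg_shiftS.
rewrite (_ : (fun n => _) = series u) //.
apply/funext => n; rewrite seriesEord seriesEord /= big_ord_recl add0r.
by apply: eq_bigr.
Qed.

Lemma hassum_finite u N : (forall n, (N <= n)%N -> u n = 0) ->
  hassum u (\sum_(n < N) u n).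
Proof.
move=> u0; apply: cvg_near_cst; exists N => // n /= leNn.
rewrite seriesEord /= -(big_mkord xpredT) (@big_cat_nat _ _ _ N) //=.
rewrite [X in _ + X]big_nat_cond [X in _ + X]big1 ?addr0 ?big_mkord //.
by move=> i /andP[/andP[lei _] _]; exact: u0.
Qed.

Lemma geometric_sum_le r n : 0 <= r < 1 -> \sum_(i < n) r ^+ i <= (1 - r)^-1.
Proof.
move=> /andP[r0 r1]; have s0 : 0 < 1 - r by rewrite subr_gt0.
rewrite -[leRHS]mulr1 ler_pdivlMl // -opprB mulNr -subrX1 opprB.
by rewrite lerBlDr lerDl exprn_ge0.
Qed.

Lemma hassum_geometric_tail u C r :
  0 <= C -> 0 <= r < 1 -> (forall n, `|u n| <= C * r ^+ n) ->
  exists2 l, hassum u l &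
    forall M, `|l - \sum_(i < M) u i| <= C * r ^+ M / (1 - r).
Proof.
move=> C0 r01 ub; have /andP[r0 r1] := r01.
have s0 : 0 < 1 - r by rewrite subr_gt0.
have cu : cvgn (series u).
  apply: normed_cvg; apply: (@series_le_cvg _ _ (geometric C r)) => //=.
  - by move=> n; rewrite mulr_ge0 // exprn_ge0.
  - by apply: is_cvg_geometric_series; rewrite ger0_norm.
exists (limn (series u)) => // M.
have hc : (fun n => `|series u n - \sum_(i < M) u i|) @ \oo -->
    `|limn (series u) - \sum_(i < M) u i|.
  by apply: cvg_norm; apply: cvgB => //; exact: cvg_cst.
rewrite -(cvg_lim _ hc) //; apply: limr_le; first exact: cvgP hc.
exists M => // n /= leMn.
have -> : \sum_(i < M) u i = series u M by rewrite seriesEord.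
rewrite sub_series_geq //; apply: le_trans (ler_norm_sum _ _ _) _.
apply: (@le_trans _ _ (\sum_(M <= k < n) C * r ^+ k)); first exact: ler_sum.
rewrite -mulr_sumr -mulrA ler_wpM2l // -{1}[M]add0n big_addn big_mkord.
under eq_bigr => i _ do rewrite exprD mulrC.
by rewrite -mulr_sumr ler_wpM2l ?exprn_ge0 // geometric_sum_le.
Qed.

Lemma triangle_sum (a : nat -> nat -> R) N :
  \sum_(n < N) \sum_(k < n.+1) a k (n - k)%N =
  \sum_(k < N) \sum_(m < N - k) a k m.
Proof.
elim: N => [|N IH]; first by rewrite !big_ord0.
rewrite big_ord_recr IH /= [RHS]big_ord_recr /= subSnn big_ord1.
rewrite [in LHS]big_ord_recr /= subnn addrA -big_split /=; congr (_ + _).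
by apply: eq_bigr => k _; rewrite subSn ?(ltnW (ltn_ord k)) // big_ord_recr.
Qed.

(** Partial sums by diagonals run over a triangle, so they differ from the partial sums of the row
    sums only by the tails of finitely many rows. *)
Lemma hassum_rearrange (a : nat -> nat -> R) (c : nat -> R) C r l :
  0 <= C -> 0 <= r < 1 -> (forall k m, `|a k m| <= C * r ^+ (k + m)) ->
  (forall k, hassum (a k) (c k)) ->
  hassum (fun n => \sum_(k < n.+1) a k (n - k)%N) l -> hassum c l.
Proof.
move=> C0 /andP[r0 r1] ab ac hl.
(* With r < s < 1 the tail of row k after N - k terms is at most a constant times s^N (r/s)^k, which
   sums over k to a multiple of s^N. *)
pose s := (1 + r) / 2; have s0 : 0 < s by rewrite /s; lra.
have s1 : s < 1 by rewrite /s; lra.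
have rs : r < s by rewrite /s; lra.
clearbody s.
have s1' : 0 < 1 - s by rewrite subr_gt0.
have rs0 : 0 <= r / s by rewrite divr_ge0 // ltW.
have rs1 : r / s < 1 by rewrite ltr_pdivrMr // mul1r.
have tail k M : `|c k - \sum_(m < M) a k m| <= C * r ^+ k * s ^+ M / (1 - s).
  have [|||l' hl' tl'] := @hassum_geometric_tail (a k) (C * r ^+ k) s.
  - by rewrite mulr_ge0 // exprn_ge0.
  - by rewrite (ltW s0).
  - move=> m; apply: le_trans (ab k m) _; rewrite exprD mulrA.
    apply: ler_wpM2l; first by rewrite mulr_ge0 // exprn_ge0.
    by apply: lerXn2r; rewrite ?nnegrE // ltW.
  by rewrite (hassum_uniq (ac k) hl').
pose K := C / (1 - s) / (1 - r / s).
have close N : `|series c N - series (fun n => \sum_(k < n.+1) a k (n - k)%N) N|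
    <= K * s ^+ N.
  rewrite !seriesEord /= triangle_sum -sumrB.
  apply: le_trans (ler_norm_sum _ _ _) _.
  apply: (@le_trans _ _ (\sum_(k < N) C / (1 - s) * s ^+ N * (r / s) ^+ k)).
    apply: ler_sum => k _; apply: le_trans (tail k _) _.
    have -> : s ^+ N = s ^+ k * s ^+ (N - k).
      by rewrite -exprD subnKC // ltnW.
    rewrite expr_div_n le_eqVlt; apply/orP; left; apply/eqP.
    have := expf_neq0 k (lt0r_neq0 s0); have := lt0r_neq0 s1'.
    by move: (s ^+ k) (s ^+ (N - k)) => x y h1 h2; field; rewrite h1 h2.
  rewrite -mulr_sumr /K -!mulrA ler_wpM2l // ler_wpM2l ?invr_ge0 ?(ltW s1') //.
  rewrite [leRHS]mulrC ler_wpM2l ?exprn_ge0 ?(ltW s0) //.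
  by apply: geometric_sum_le; rewrite rs0.
apply: cvg_sub0 hl; apply/cvgr0Pnorm_lt => e e0.
have : geometric K s @ \oo --> 0 by apply: cvg_geometric; rewrite ger0_norm ?ltW.
move=> /cvgr0_norm_lt /(_ e e0) [N _ HN]; exists N => // n /= leNn.
apply: le_lt_trans (close n) _; apply: le_lt_trans (ler_norm _) _.
exact: HN.
Qed.

End HasSum.

Arguments hassumZ {R} c {u l} _.

(** * Growth of the coefficients and bounds for Pochhammer symbols *)

Section Growth.
Local Open Scope classical_set_scope.
Variables (R : realType) (q : R).
Hypothesis q1 : `|q| < 1.
Implicit Types (u : nat -> R) (r : R).

Definition geom_le u r := exists2 C, 0 <= C & forall n, `|u n| <= C * r ^+ n.

Lemma eventually_geometric_le M (e : R) : 0 < e ->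
  exists N, forall n, (N <= n)%N -> M * `|q| ^+ n <= e.
Proof.
move=> e0.
have : geometric M `|q| @ \oo --> 0 by apply: cvg_geometric; rewrite normr_id.
move=> /cvgr0_norm_lt /(_ e e0) [N _ HN]; exists N => n leNn.
by apply/ltW; apply: le_lt_trans (ler_norm _) _; exact: HN.
Qed.

Lemma geom_le_eventually u r C N : 0 < r -> 0 <= C ->
  (forall n, (N <= n)%N -> `|u n| <= C * r ^+ n) -> geom_le u r.
Proof.
move=> r0 C0 h; pose D := \sum_(i < N) `|u i| / r ^+ i.
have D0 : 0 <= D by apply: sumr_ge0 => i _; rewrite divr_ge0 // exprn_ge0 // ltW.
exists (C + D) => [|n]; first exact: addr_ge0.
case: (leqP N n) => [leNn|ltnN].
  by apply: le_trans (h n leNn) _; rewrite ler_wpM2r ?exprn_ge0 ?(ltW r0) // lerDl.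
rewrite -ler_pdivrMr ?exprn_gt0 //; apply: (@le_trans _ _ D); last by rewrite lerDr.
rewrite /D (bigD1 (Ordinal ltnN)) //= lerDl; apply: sumr_ge0 => i _.
by rewrite divr_ge0 // exprn_ge0 // ltW.
Qed.

(** Every coefficient of the recurrence carries a power of q growing with n, so the sequence decays
    faster than any geometric one; r may be as small as desired. *)
Lemma qquot0_geom_le (B b r : R) : 0 < r -> geom_le (qquot q 0 0 B b) r.
Proof.
move=> r0; set u := qquot q 0 0 B b; pose M := `|B| + 2 * `|b|.
have M0 : 0 <= M by rewrite addr_ge0 // mulr_ge0.
have rec n : `|u n.+2| <= M * `|q| ^+ n * (`|u n.+1| + `|u n|).
  rewrite /u qquotS succnK -/u.
  have -> : (0 - B * q ^+ n.+1) * u n.+1 - (0 - b * q ^+ n) * (1 - q ^+ n.+1) * u n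
    = - (B * q) * q ^+ n * u n.+1 + b * (1 - q ^+ n.+1) * q ^+ n * u n.
    by rewrite exprS; ring.
  apply: le_trans (ler_normD _ _) _; rewrite [leRHS]mulrDr.
  have qn : `|q ^+ n.+1| <= 1 by rewrite normrX exprn_ile1 // ltW.
  apply: lerD; rewrite !normrM normrX ler_wpM2r // ler_wpM2r ?exprn_ge0 //.
    rewrite normrN normrM /M; apply: (@le_trans _ _ `|B|).
      by rewrite ler_piMr // ltW.
    by rewrite lerDl mulr_ge0.
  rewrite mulrC /M; apply: (@le_trans _ _ (2 * `|b|)); last by rewrite lerDr.
  rewrite ler_wpM2r //; apply: le_trans (ler_normB _ _) _.
  by rewrite normr1; lra.
(* The threshold r^2 / (r + 1) is the value for which the bound reproduces itself: r^2 / (r + 1) *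
   (r^(n+1) + r^n) = r^(n+2). *)
have [N HN] := eventually_geometric_le M (divr_gt0 (exprn_gt0 2 r0)
  (ltr_wpDl (ltW r0) ltr01 : 0 < r + 1)).
pose C := `|u N| / r ^+ N + `|u N.+1| / r ^+ N.+1.
have C0 : 0 <= C by rewrite addr_ge0 // divr_ge0 // exprn_ge0 // ltW.
apply: (@geom_le_eventually _ _ C N) => // n leNn.
have rX k : 0 < r ^+ k by exact: exprn_gt0.
suff : `|u n| <= C * r ^+ n /\ `|u n.+1| <= C * r ^+ n.+1 by case.
elim: n leNn => [|n IH].
  rewrite leqn0 => /eqP N0; rewrite /C N0 /= expr0 expr1 !divr1; split.
    by rewrite mulr1 lerDl divr_ge0 // ltW.
  by rewrite mulrDl divfK ?lt0r_neq0 // lerDr mulr_ge0 // ltW.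
rewrite leq_eqVlt => /orP[/eqP <-|]; last rewrite ltnS => leNn.
  rewrite /C !mulrDl !divfK ?lt0r_neq0 // lerDl lerDr.
  by split; rewrite mulr_ge0 ?divr_ge0 // ltW.
have [h0 h1] := IH leNn; split => //; apply: le_trans (rec n) _.
apply: (@le_trans _ _ (r ^+ 2 / (r + 1) * (C * r ^+ n.+1 + C * r ^+ n))).
  apply: ler_pM; rewrite ?addr_ge0 ?mulr_ge0 ?exprn_ge0 //; last exact: lerD.
  exact: HN.
rewrite -mulrDr !exprS le_eqVlt; apply/orP; left; apply/eqP; field.
by rewrite lt0r_neq0 // ltr_wpDl // ltW.
Qed.

(* The recurrence is an exponentially small perturbation of the one with roots
   u and v = 1 / u on the unit circle, so that a n.+1 - u a n and a n.+1 grow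
   slower than any r ^+ n with r > 1. *)
Lemma qquot_geom_le (x B b r : R) :
  -1 <= x <= 1 -> 1 < r -> geom_le (qquot q (2 * x) 1 B b) r.
Proof.
move=> /andP[x0 x1] r1; set a := qquot _ _ _ _ _.
have r0 : 0 < r by exact: lt_trans r1.
pose s := Num.sqrt (1 - x ^+ 2).
have s2 : s ^+ 2 = 1 - x ^+ 2 by rewrite sqr_sqrtr // subr_ge0; nra.
pose u : R[i] := (x +i* s)%C; pose v : R[i] := (x +i* (- s))%C.
have uv : u * v = 1.
  by apply/eqP; rewrite eq_complex /=; apply/andP; split; apply/eqP; nra.
have uDv : u + v = (2 * x)%:C%C.
  by apply/eqP; rewrite eq_complex /=; apply/andP; split; apply/eqP; ring.
have nc t : Normc.normc (t%:C%C : R[i]) = `|t|.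
  by rewrite /Normc.normc /= expr0n addr0 sqrtr_sqr.
have nu : Normc.normc u = 1 by rewrite /Normc.normc /= s2 subrKC sqrtr1.
have nv : Normc.normc v = 1 by rewrite /Normc.normc /= sqrrN s2 subrKC sqrtr1.
pose d n := Normc.normc ((a n.+1)%:C%C - u * (a n)%:C%C).
have d0 n : 0 <= d n by rewrite /d; case: (_ - _) => ? ?; exact: sqrtr_ge0.
have ad n : `|a n.+1| <= `|a n| + d n.
  rewrite -!nc -[Normc.normc (a n)%:C%C]mul1r -nu -Normc.normcM addrC.
  by apply: le_trans (le_normcD _ _); rewrite subrK.
pose M := `|B| + 2 * `|b| + 1.
have M0 : 0 <= M by rewrite !addr_ge0 // mulr_ge0.
have dd n : d n.+1 <= d n + M * `|q| ^+ n * (`|a n.+1| + `|a n|).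
  pose e := - (B * q * q ^+ n * a n.+1) + (b * q ^+ n + q * q ^+ n
      - b * q ^+ n * (q * q ^+ n)) * a n.
  (* As u + v = 2x and uv = 1, the unperturbed recurrence factors, and a n.+2 - u a n.+1 = v (a n.+1
     - u a n) + e. *)
  have -> : d n.+1 = Normc.normc (v * ((a n.+1)%:C%C - u * (a n)%:C%C) + e%:C%C).
    congr Normc.normc.
    have -> : a n.+2 = 2 * x * a n.+1 - a n + e.
      by rewrite /e /a qquotS succnK exprS; ring.
    rewrite rmorphD rmorphB rmorphM /= -uDv mulrBr [v * (u * _)]mulrA [v * u]mulrC uv.
    by ring.
  apply: le_trans (le_normcD _ _) _.
  rewrite Normc.normcM nv mul1r lerD2l nc.
  apply: le_trans (ler_normD _ _) _; rewrite [leRHS]mulrDr normrN.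
  have qn : `|q ^+ n| <= 1 by rewrite normrX exprn_ile1 // ltW.
  apply: lerD.
    rewrite 3!normrM normrX ler_wpM2r // ler_wpM2r ?exprn_ge0 //.
    apply: (@le_trans _ _ `|B|); first by rewrite ler_piMr // ltW.
    by rewrite /M -addrA lerDl addr_ge0 // mulr_ge0.
  have -> : b * q ^+ n + q * q ^+ n - b * q ^+ n * (q * q ^+ n) =
     (b + q - b * q * q ^+ n) * q ^+ n by ring.
  rewrite 2!normrM [`|q ^+ n|]normrX ler_wpM2r // ler_wpM2r ?exprn_ge0 //.
  apply: le_trans (ler_normB _ _) _.
  have h1 : `|b * q * q ^+ n| <= `|b|.
    by rewrite 2!normrM -mulrA ler_piMr // mulr_ile1 // ltW.
  have h2 := ler_normD b q; have := normr_ge0 B.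
  rewrite /M; move: h1 h2 q1.
  by move: `|b * q * q ^+ n| `|b + q| `|q| `|b| `|B| => t1 t2 t3 t4 t5 *; lra.
pose de := r - 1; have de0 : 0 < de by rewrite subr_gt0.
(* The bounds C r^n for a and C de r^n for d reproduce themselves: the perturbation is at most C
   de^2 r^n, and r = 1 + de. *)
have [N HN] := eventually_geometric_le M (divr_gt0 (exprn_gt0 2 de0)
  (ltr_wpDl (ltW r0) ltr01 : 0 < r + 1)).
pose C := `|a N| + d N / de.
have C0 : 0 <= C by rewrite addr_ge0 // divr_ge0 // ltW.
apply: (@geom_le_eventually _ _ C N) => // n leNn.
suff : `|a n| <= C * r ^+ n /\ d n <= C * de * r ^+ n by case.
elim: n leNn => [|n IH].
  rewrite leqn0 => /eqP N0; rewrite /C N0 /= expr0 !mulr1; split.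
    by rewrite lerDl divr_ge0 // ltW.
  by rewrite mulrDl divfK ?lt0r_neq0 // lerDr mulr_ge0 // ltW.
rewrite leq_eqVlt => /orP[/eqP <-|]; last rewrite ltnS => leNn.
  have h : 1 <= r ^+ N by rewrite exprn_ege1 // ltW.
  split.
    apply: (@le_trans _ _ C); first by rewrite /C lerDl divr_ge0 // ltW.
    by rewrite ler_peMr.
  apply: (@le_trans _ _ (C * de)); last by rewrite ler_peMr // mulr_ge0 // ltW.
  by rewrite /C mulrDl divfK ?lt0r_neq0 // lerDr mulr_ge0 // ltW.
have [h0 h1] := IH leNn.
have h2 : `|a n.+1| <= C * r ^+ n.+1.
  apply: le_trans (ad n) _; apply: le_trans (lerD h0 h1) _.
  by rewrite exprS le_eqVlt; apply/orP; left; apply/eqP; rewrite /de; ring.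
split => //; apply: le_trans (dd n) _.
apply: (@le_trans _ _ (C * de * r ^+ n +
   de ^+ 2 / (r + 1) * (C * r ^+ n.+1 + C * r ^+ n))).
  apply: lerD => //; apply: ler_pM; rewrite ?addr_ge0 ?mulr_ge0 ?exprn_ge0 //.
    exact: HN.
  exact: lerD.
rewrite [r ^+ n.+1]exprS le_eqVlt; apply/orP; left; apply/eqP.
have r10 : r + 1 != 0 by rewrite lt0r_neq0 // ltr_wpDl // ltW.
by rewrite /de; move: (C) (r ^+ n) => c X; field.
Qed.

(** Base 8 suffices because 4 * 8^(n+1) + 4 * 8^n <= 8^(n+2). In contrast to [qquot_geom_le] the
    constant is the same for all parameters, which may therefore vary with the degree. *)
Lemma qquot_crude (A a B b : R) n :
  `|A| <= 2 -> `|B| <= 2 -> `|a| <= 1 -> `|b| <= 1 ->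
  `|qquot q A a B b n| <= 8 ^+ n.
Proof.
move=> hA hB ha hb.
have qX k : `|q ^+ k| <= 1 by rewrite normrX exprn_ile1 // ltW.
suff : `|qquot q A a B b n| <= 8 ^+ n /\ `|qquot q A a B b n.+1| <= 8 ^+ n.+1 by case.
have step k : `|A - B * q ^+ k| <= 4.
  apply: le_trans (ler_normB _ _) _; rewrite normrM.
  by have := ler_piMr (normr_ge0 B) (qX k); lra.
have step' k k' : `|(a - b * q ^+ k) * (1 - q ^+ k')| <= 4.
  rewrite normrM.
  have h1 : `|a - b * q ^+ k| <= 2.
    apply: le_trans (ler_normB _ _) _; rewrite normrM.
    by have := ler_piMr (normr_ge0 b) (qX k); lra.
  have h2 : `|1 - q ^+ k'| <= 2.
    by apply: le_trans (ler_normB _ _) _; rewrite normr1; have := qX k'; lra.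
  by have := ler_pM (normr_ge0 _) (normr_ge0 _) h1 h2; lra.
elim: n => [|n [h0 h1]].
  rewrite qquotS expr0 subrr mulr0 mul0r subr0 /qquot /= mulr1 normr1 expr1.
  by split => //; have := step 0%N; rewrite expr0; lra.
split => //; rewrite qquotS succnK; apply: le_trans (ler_normB _ _) _.
rewrite normrM [X in _ + X]normrM.
have p0 : 0 <= 8 ^+ n :> R by rewrite exprn_ge0.
have e1 : `|A - B * q ^+ n.+1| * `|qquot q A a B b n.+1| <= 4 * 8 ^+ n.+1.
  exact: ler_pM.
have e2 : `|(a - b * q ^+ n) * (1 - q ^+ n.+1)| * `|qquot q A a B b n| <= 4 * 8 ^+ n.
  exact: ler_pM.
by apply: le_trans (lerD e1 e2) _; rewrite !exprS; lra.
Qed.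

(** Both bounds rest on 1 + u <= exp u, the lower one through 1 / (1 - t) <= 1 + |t| / (1 - a0), and
    on the geometric series of |q|^j; hence e serves all a and n simultaneously. *)
Lemma qpoch_bounds (a0 : R) : 0 <= a0 < 1 ->
  exists2 e, 0 < e & forall a n, `|a| <= a0 -> e <= qpoch a q n <= e^-1.
Proof.
move=> /andP[a00 a01]; have s0 : 0 < 1 - a0 by rewrite subr_gt0.
pose S := (1 - a0)^-1 * (1 - `|q|)^-1.
exists (expR (- S)) => [|a n ha]; first exact: expR_gt0.
have aq j : `|a * q ^+ j| <= `|q| ^+ j.
  by rewrite normrM normrX ler_piMl ?exprn_ge0 // (le_trans ha) // ltW.
have aq' j : `|a * q ^+ j| <= a0.
  by rewrite normrM normrX (le_trans _ ha) // ler_piMr // exprn_ile1 // ltW.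
have e1 : \sum_(j < n) (1 - a0)^-1 * `|q| ^+ j <= S.
  rewrite -mulr_sumr ler_wpM2l ?invr_ge0 ?(ltW s0) //.
  by apply: geometric_sum_le; rewrite normr_ge0.
have i1 : 1 <= (1 - a0)^-1 by rewrite invf_ge1 // gerBl.
rewrite -expRN opprK /qpoch; apply/andP; split.
  apply: (@le_trans _ _ (expR (\sum_(j < n) - ((1 - a0)^-1 * `|q| ^+ j)))).
    by rewrite ler_expR sumrN lerN2.
  rewrite expR_sum; apply: ler_prod => j _; rewrite expR_ge0 /=.
  have h : a * q ^+ j <= a0 by exact: le_trans (ler_norm _) (aq' j).
  have p : 0 < 1 - a * q ^+ j by lra.
  rewrite expRN -[leRHS]invrK lef_pV2 ?posrE ?invr_gt0 ?expR_gt0 //.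
  apply: le_trans (expR_ge1Dx _); rewrite -(ler_pM2r p) mulVf ?lt0r_neq0 //.
  have := aq j; have := ler_norm (a * q ^+ j).
  have : (1 - a0)^-1 * (1 - a0) = 1 by rewrite mulVf // lt0r_neq0.
  have : 0 <= `|q| ^+ j by rewrite exprn_ge0.
  move: i1 h; move: (a * q ^+ j) `|a * q ^+ j| (`|q| ^+ j) ((1 - a0)^-1).
  move=> t nt Q I i1 h Q0 eI l1 l2.
  have k1 : 1 <= I * (1 - t).
    rewrite -[leLHS]eI.
    by apply: ler_wpM2l; [exact: le_trans i1|rewrite lerD2l lerN2].
  have k2 : Q <= Q * (I * (1 - t)) by rewrite ler_peMr.
  have -> : (1 + I * Q) * (1 - t) = 1 - t + Q * (I * (1 - t)) by ring.
  by lra.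
apply: (@le_trans _ _ (expR (\sum_(j < n) ((1 - a0)^-1 * `|q| ^+ j)))); last first.
  by rewrite ler_expR.
rewrite expR_sum; apply: ler_prod => j _.
have h : a * q ^+ j <= a0 by exact: le_trans (ler_norm _) (aq' j).
rewrite subr_ge0 (le_trans h) ?(ltW a01) //=.
apply: le_trans (expR_ge1Dx _); rewrite lerD2l -[leLHS]mulN1r mulN1r.
apply: le_trans (ler_norm _) _; rewrite normrN; apply: le_trans (aq j) _.
by rewrite ler_peMl // exprn_ge0.
Qed.

Lemma qpoch_cvg (a : R) : `|a| < 1 ->
  exists2 l : R, 0 < l & qpoch a q @ \oo --> l.
Proof.
move=> a1; have [|e e0 he] := @qpoch_bounds `|a|; first by rewrite normr_ge0.
have ei : 0 <= e^-1 by rewrite invr_ge0 ltW.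
have cP : cvgn (qpoch a q).
  have [||n|l hl _] := @hassum_geometric_tail _ (telescope (qpoch a q)) e^-1 `|q|.
  - by [].
  - by rewrite normr_ge0.
  - rewrite /telescope /= qpochS mulrBr mulr1 addrAC subrr add0r normrN !normrM.
    have /andP[h1 h2] := he a n (lexx _).
    rewrite ger0_norm; last by apply: le_trans h1; exact: ltW.
    apply: ler_pM => //; first by apply: le_trans h1; exact: ltW.
    by rewrite normrX ler_piMl ?exprn_ge0 // ltW.
  apply/cvg_ex; exists (l + 1); move: hl; rewrite /hassum telescopeK => hl.
  have -> : qpoch a q = (fun n => (qpoch a q n - qpoch a q 0) + 1).
    by apply/funext => n; rewrite qpoch0 subrK.
  by apply: cvgD => //; exact: cvg_cst.
exists (limn (qpoch a q)) => //; apply: (lt_le_trans e0).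
by apply: limr_ge => //; near=> n; have /andP[] := he a n (lexx _).
Unshelve. all: by end_near. Qed.

End Growth.

(** * The Poisson-Mehler kernel and its product form *)

Section PoissonMehler.
Local Open Scope classical_set_scope.
Variables (R : realType) (q : R).
Hypothesis q1 : `|q| < 1.
Implicit Types (x y z s r : R).

Lemma qpochqq_neq0 n : qpoch q q n != 0.
Proof.
apply/prodf_neq0 => i _; rewrite subr_eq0 eq_sym -exprS.
apply/negP => /eqP h; have : `|q ^+ i.+1| < 1 by rewrite normrX exprn_ilt1.
by rewrite h normr1 ltxx.
Qed.

Lemma mul_exp_neq1 (a : R) k : `|a| < 1 -> a * q ^+ k != 1.
Proof.
move=> a1; apply/negP => /eqP h.
have : `|a * q ^+ k| < 1.
  by rewrite normrM normrX (le_lt_trans _ a1) // ler_piMr // exprn_ile1 // ltW.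
by rewrite h normr1 ltxx.
Qed.

Lemma exp_neq1 k : (0 < k)%N -> q ^+ k != 1.
Proof. by case: k => // k _; rewrite exprS mul_exp_neq1. Qed.

Lemma sqr_norm_lt1 s : `|s| < 1 -> `|s ^+ 2| < 1.
Proof. by move=> s1; rewrite normrX exprn_ilt1. Qed.

(** The two Hermite factors of the kernel grow at most like r^m each; this r lets s^m absorb
    both. *)
Lemma pick_ratio s : `|s| < 1 -> exists2 r, 1 < r & `|s| * r ^+ 2 < 1.
Proof.
move=> s1; exists (1 + (1 - `|s|) / 4); first by lra.
by have := normr_ge0 s; nra.
Qed.

Definition pmterm z y s k l m : R :=
  s ^+ m / qpoch q q m * qquot q (2 * z) 1 0 0 (k + m)
  * qquot q (2 * y) 1 0 0 (l + m).

(* PM z y s 0 0 is the Poisson-Mehler kernel f_CN(z|y,s,q) / f_h(z|q). *)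
Definition PM z y s k l : R := limn (series (pmterm z y s k l)).

Lemma pmterm_le z y k l r : -1 <= z <= 1 -> -1 <= y <= 1 -> 1 < r ->
  exists2 C, 0 <= C &
    forall s m, `|pmterm z y s k l m| <= C * (`|s| * r ^+ 2) ^+ m.
Proof.
move=> hz hy r1; have r0 : 0 < r by exact: lt_trans r1.
have [Cz Cz0 Hz] := qquot_geom_le q1 0 0 hz r1.
have [Cy Cy0 Hy] := qquot_geom_le q1 0 0 hy r1.
have [|e e0 He] := @qpoch_bounds _ _ q1 `|q|; first by rewrite normr_ge0.
exists (e^-1 * (Cz * r ^+ k) * (Cy * r ^+ l)) => [|s m].
  by rewrite !mulr_ge0 ?invr_ge0 ?exprn_ge0 // ltW.
have /andP[h1 h2] := He q m (lexx _).
have Pm : 0 < qpoch q q m by exact: lt_le_trans h1.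
rewrite /pmterm !normrM normfV normrX [`|qpoch _ _ _|]gtr0_norm //.
apply: (@le_trans _ _ (`|s| ^+ m * e^-1 * (Cz * r ^+ (k + m)) * (Cy * r ^+ (l + m)))).
  apply: ler_pM => //; first by rewrite !mulr_ge0 ?invr_ge0 ?exprn_ge0 // ltW.
  apply: ler_pM => //; first by rewrite !mulr_ge0 ?invr_ge0 ?exprn_ge0 // ltW.
  by rewrite ler_wpM2l ?exprn_ge0 // lef_pV2 ?posrE.
rewrite !exprD exprMn -exprM mulnC exprM le_eqVlt; apply/orP; left; apply/eqP.
by ring.
Qed.

Lemma hassum_PM z y s k l : -1 <= z <= 1 -> -1 <= y <= 1 -> `|s| < 1 ->
  hassum (pmterm z y s k l) (PM z y s k l).
Proof.
move=> hz hy s1; have [r r1 sr1] := pick_ratio s1.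
have [C C0 HC] := pmterm_le k l hz hy r1.
have [|l' hl' _] := hassum_geometric_tail C0 _ (HC s).
  by rewrite sr1 mulr_ge0 // exprn_ge0 // (le_trans ler01) // ltW.
by rewrite /PM (hassum_lim hl').
Qed.

Lemma PM_sym z y s k l : PM z y s k l = PM y z s l k.
Proof.
by rewrite /PM; congr (limn (series _)); apply/funext => m; rewrite /pmterm mulrAC.
Qed.

Section Recurrences.
Variables (z y s : R).
Hypotheses (hz : -1 <= z <= 1) (hy : -1 <= y <= 1) (s1 : `|s| < 1).

(** Since 1 - q^(k+m) = (1 - q^k) + q^k (1 - q^m), the last term of the Hermite recurrence splits;
    its second part cancels a factor of (q)_m and shifts m, which raises l. *)
Lemma PM_recl k l : PM z y s k.+1 l = 2 * z * PM z y s k l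
  - (1 - q ^+ k) * PM z y s k.-1 l - q ^+ k * s * PM z y s k l.+1.
Proof.
have H k' l' := @hassum_PM z y s k' l' hz hy s1.
apply: hassum_uniq (H _ _) _.
have := hassumD (hassumD (hassumZ (2 * z) (H k l))
   (hassumZ (- (1 - q ^+ k)) (H k.-1 l)))
   (hassumZ (- (q ^+ k * s)) (hassum_shift (H k l.+1))).
rewrite !mulNr; apply: eq_hassum => m.
have e : (1 - q ^+ k) * qquot q (2 * z) 1 0 0 (k.-1 + m) =
          (1 - q ^+ k) * qquot q (2 * z) 1 0 0 (k + m).-1.
  by case: (k) => [|k']; rewrite ?expr0 ?subrr ?mul0r.
rewrite /pmterm /= addSn qquotS.
set h1 := qquot _ _ _ _ _ (k + m); set h2 := qquot _ _ _ _ _ (l + m).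
set t := match m with 0%N => _ | _ => _ end.
transitivity (s ^+ m / qpoch q q m * h2 * (2 * z * h1 -
   (1 - q ^+ k) * qquot q (2 * z) 1 0 0 (k.-1 + m)) - q ^+ k * s * t).
  by move: t => t; ring.
rewrite e /h1 /h2 /t {t e h1 h2}; case: m => [|m].
  by rewrite !addn0 qpoch0 expr0 divr1; ring.
rewrite !addnS succnK addSn qpochS.
have := qpochqq_neq0 m; have := qpochqq_neq0 m.+1; rewrite qpochS mulf_eq0 negb_or.
move=> /andP[_ h] h'; rewrite -exprS in h.
have -> : q ^+ (k + m).+1 = q ^+ k * q ^+ m.+1 by rewrite -addnS exprD.
rewrite -exprS [s ^+ m.+1]exprSr.
move: (qquot _ _ _ _ _ _) (qquot _ _ _ _ _ _) (qquot _ _ _ _ _ _).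
move: h' h; move: (qpoch q q m) (q ^+ m.+1) (q ^+ k) (s ^+ m) => P Qm Qk S h' h a b c.
by field; rewrite h h'.
Qed.

End Recurrences.

Lemma PM_recr z y s k l : -1 <= z <= 1 -> -1 <= y <= 1 -> `|s| < 1 ->
  PM z y s k l.+1 = 2 * y * PM z y s k l
  - (1 - q ^+ l) * PM z y s k l.-1 - q ^+ l * s * PM z y s k.+1 l.
Proof. by move=> hz hy s1; rewrite !(PM_sym z) PM_recl. Qed.

Lemma PM_Carlitz z y s k : -1 <= z <= 1 -> -1 <= y <= 1 -> `|s| < 1 ->
  PM z y s k 0 = ASC z y s q k / qpoch (s ^+ 2) q k * PM z y s 0 0.
Proof.
move=> hz hy s1; have s2 i : 1 - s ^+ 2 * q ^+ i != 0.
  by rewrite subr_eq0 eq_sym mul_exp_neq1 // sqr_norm_lt1.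
(* At l = 0 the term with [l.-1] has the factor 1 - q^0, so the second recurrence eliminates PM i 1
   and a recurrence in i alone remains. *)
have rec i : (1 - s ^+ 2 * q ^+ i) * PM z y s i.+1 0 =
   2 * (z - s * y * q ^+ i) * PM z y s i 0 - (1 - q ^+ i) * PM z y s i.-1 0.
  have e := PM_recl hz hy s1 i 0.
  rewrite (PM_recr i 0 hz hy s1) expr0 subrr mul0r subr0 mul1r in e.
  by rewrite mulrBl mul1r {1}e; ring.
elim/ltn_ind: k => -[_|k IH].
  by rewrite qpoch0 /= divr1 mul1r.
apply: (mulfI (s2 k)); rewrite rec IH //.
rewrite [ASC _ _ _ _ k.+1]ASC_qquot qquotS -!ASC_qquot qpochS.
have P0 i : qpoch (s ^+ 2) q i != 0.
  by apply: qpoch_neq0 => j; rewrite mul_exp_neq1 // sqr_norm_lt1.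
case: k IH => [|k] IH.
  by have := s2 0%N; rewrite !expr0 mulr1 qpoch0 /= => h; field.
rewrite succnK (IH k (leqW (leqnn _))).
rewrite !qpochS; have := P0 k; have := s2 k; have := s2 k.+1.
move: (PM _ _ _ _ _) (ASC _ _ _ _ k.+1) (ASC _ _ _ _ k) (qpoch _ _ _) => p a b P.
rewrite exprS; move: (q ^+ k) => Q h1 h2 h3; field; rewrite h1 h2 h3 //.
Qed.

(** From q^m / (q)_m = 1 / (q)_m - 1 / (q)_(m-1) the kernel at q s equals PM 0 0 - s PM 1 1 at s,
    and the recurrences reduce PM 1 1 to a multiple of PM 0 0. *)
Lemma PM_dilate z y s : -1 <= z <= 1 -> -1 <= y <= 1 -> `|s| < 1 ->
  (1 - s ^+ 2) * (1 - s ^+ 2 * q) * PM z y (q * s) 0 0 = AWw z y s * PM z y s 0 0.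
Proof.
move=> hz hy s1.
have qs1 : `|q * s| < 1 by rewrite normrM mulr_ilt1.
have e : PM z y (q * s) 0 0 = PM z y s 0 0 - s * PM z y s 1 1.
  apply: hassum_uniq (@hassum_PM z y _ 0 0 hz hy qs1) _.
  have := hassumD (@hassum_PM z y _ 0 0 hz hy s1)
    (hassumZ (- s) (hassum_shift (@hassum_PM z y _ 1 1 hz hy s1))).
  rewrite mulNr; apply: eq_hassum => -[|m]; rewrite /pmterm.
    by rewrite !expr0; ring.
  have := qpochqq_neq0 m; have := qpochqq_neq0 m.+1; rewrite qpochS mulf_eq0 negb_or.
  move=> /andP[_ h] h'; rewrite -exprS in h.
  rewrite !add0n !add1n -exprS exprMn [s ^+ m.+1]exprS.
  move: (qquot _ _ _ _ _ _) (qquot _ _ _ _ _ _).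
  move: h' h; move: (qpoch q q m) (q ^+ m.+1) (s ^+ m) => P Qm S h' h a b.
  by field; rewrite h h'.
have h1 : 1 - s ^+ 2 != 0.
  by have := mul_exp_neq1 0 (sqr_norm_lt1 s1); rewrite expr0 mulr1 subr_eq0 eq_sym.
have h2 : 1 - s ^+ 2 * q != 0.
  by have := mul_exp_neq1 1 (sqr_norm_lt1 s1); rewrite expr1 subr_eq0 eq_sym.
rewrite e PM_recr // (@PM_Carlitz z y s 1) // (@PM_Carlitz z y s 2) //.
rewrite !qpochS qpoch0 /AWw /= !expr0 !expr1.
by move: (PM _ _ _ _ _) => P; field; rewrite h1 h2.
Qed.

Lemma PM_iter z y s n : -1 <= z <= 1 -> -1 <= y <= 1 -> `|s| < 1 ->
  qpoch (s ^+ 2) q (2 * n) * PM z y (s * q ^+ n) 0 0 =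
  \prod_(j < n) AWw z y (s * q ^+ j) * PM z y s 0 0.
Proof.
move=> hz hy s1; elim: n => [|n IH].
  by rewrite qpoch0 big_ord0 expr0 mulr1.
have sn : `|s * q ^+ n| < 1.
  by rewrite normrM normrX (le_lt_trans _ s1) // ler_piMr // exprn_ile1 // ltW.
rewrite big_ord_recr /= mulrAC -IH mulnS add2n !qpochS.
have -> : s * q ^+ n.+1 = q * (s * q ^+ n) by rewrite exprS; ring.
rewrite [RHS]mulrAC -[RHS]mulrA -(PM_dilate hz hy sn).
have -> : q ^+ (2 * n).+1 = q * q ^+ n ^+ 2 by rewrite exprS mulnC exprM.
have -> : q ^+ (2 * n) = q ^+ n ^+ 2 by rewrite mulnC exprM.
by move: (PM _ _ _ _ _) (qpoch _ _ _) => P Q; ring.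
Qed.

Lemma PM_cvg z y s : -1 <= z <= 1 -> -1 <= y <= 1 -> `|s| < 1 ->
  (fun n => PM z y (s * q ^+ n) 0 0) @ \oo --> (1 : R).
Proof.
move=> hz hy s1; have [r r1 sr1] := pick_ratio s1.
have r0 : 0 < r by exact: lt_trans r1.
have [C C0 HC] := pmterm_le 0 0 hz hy r1.
pose K := C * (`|s| * r ^+ 2) / (1 - `|s| * r ^+ 2).
have sr0 : 0 <= `|s| * r ^+ 2 by rewrite mulr_ge0 // exprn_ge0 // ltW.
apply/cvgrPdist_le => e e0.
have [N HN] := eventually_geometric_le q1 K e0.
exists N => // n /= leNn; apply: le_trans (HN n leNn).
have qn : `|q| ^+ n <= 1 by rewrite exprn_ile1 // ltW.
have t1 : `|s * q ^+ n| * r ^+ 2 <= `|s| * r ^+ 2.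
  by rewrite normrM normrX ler_wpM2r ?exprn_ge0 ?(ltW r0) // ler_piMr.
have [|l hl tl] := hassum_geometric_tail C0 _ (HC (s * q ^+ n)).
  by rewrite mulr_ge0 ?exprn_ge0 ?(ltW r0) // (le_lt_trans t1).
have := tl 1%N; rewrite big_ord1 {1}/pmterm qpoch0 expr0 /qquot /= !mulr1 divr1.
rewrite distrC => h.
rewrite /PM (hassum_lim hl); apply: le_trans h _.
have -> : K * `|q| ^+ n = C * (`|s * q ^+ n| * r ^+ 2) / (1 - `|s| * r ^+ 2).
  by rewrite /K normrM normrX; ring.
rewrite expr1; apply: ler_wpM2l.
  by rewrite !mulr_ge0 // ltW.
by rewrite lef_pV2 ?posrE ?subr_gt0 // ?lerD2l ?lerN2 // (le_lt_trans t1).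
Qed.

(** Let n tend to infinity in [PM_iter]. The limit of the left side is positive, so the kernel
    cannot vanish; dividing by it shows that the product of the w converges, as reading [infprod] as
    its value requires. *)
Lemma PM_prod z y s : -1 <= z <= 1 -> -1 <= y <= 1 -> `|s| < 1 ->
  PM z y s 0 0 != 0 /\
  PM z y s 0 0 = qpochinf (s ^+ 2) q / infprod (fun j => AWw z y (s * q ^+ j)).
Proof.
move=> hz hy s1; have [l l0 hl] := qpoch_cvg q1 (sqr_norm_lt1 s1).
have hl2 : (fun n => qpoch (s ^+ 2) q (2 * n)) @ \oo --> l.
  apply: (cvg_comp (fun n => 2 * n)%N (qpoch (s ^+ 2) q) _ hl).
  by apply/cvgnyPge => N; exists N => // n /= leNn; apply: leq_trans leNn _; rewrite leq_pmull.
have h : (fun n => \prod_(j < n) AWw z y (s * q ^+ j) * PM z y s 0 0) @ \oo --> l.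
  have -> : (fun n => \prod_(j < n) AWw z y (s * q ^+ j) * PM z y s 0 0) =
    (fun n => qpoch (s ^+ 2) q (2 * n) * PM z y (s * q ^+ n) 0 0).
    by apply/funext => n; rewrite PM_iter.
  by rewrite -[l]mulr1; apply: cvgM => //; exact: PM_cvg.
have P0 : PM z y s 0 0 != 0.
  apply/negP => /eqP P0; move: h; rewrite P0.
  have -> : (fun n => \prod_(j < n) AWw z y (s * q ^+ j) * 0) = cst 0.
    by apply/funext => n; rewrite mulr0.
  move=> h'; have l00 : l = 0 by rewrite -(cvg_lim _ h') // lim_cst.
  by move: l0; rewrite l00 ltxx.
split => //.
have hp : (fun n => \prod_(j < n) AWw z y (s * q ^+ j)) @ \oo --> l / PM z y s 0 0.
  have -> : (fun n => \prod_(j < n) AWw z y (s * q ^+ j)) =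
    (fun n => \prod_(j < n) AWw z y (s * q ^+ j) * PM z y s 0 0 / PM z y s 0 0).
    by apply/funext => n; rewrite mulfK.
  exact: cvgMr_tmp.
rewrite /qpochinf /infprod (cvg_lim _ hp) //.
have -> : limn (fun n => \prod_(j < n) (1 - s ^+ 2 * q ^+ j)) = l.
  exact/cvg_lim.
by move: P0 (lt0r_neq0 l0); move: (PM _ _ _ _ _) => P P0 l00; field; rewrite P0 l00.
Qed.

End PoissonMehler.

(** * Shifted convolutions of b_n with h_n *)

Section HermiteConvolution.
Variables (F : fieldType) (q B : F).

Lemma qconv_swap (f : nat -> nat -> F) n :
  qconv q (fun j k => (1 - q ^+ k) * f j k.-1) n =
  qconv q (fun j k => (1 - q ^+ j) * f j.-1 k) n.
Proof.
case: n => [|n]; first by rewrite !qconv0 expr0 subrr !mul0r.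
by rewrite (qconv_shiftl q f) (qconv_shiftr q f).
Qed.

Let h := qquot q B 1 0 0.
Let b := qquot q 0 0 B 1.
Let X m N := qconv q (fun k i => q ^+ (m * i) * b (m + k) * h i) N.

(** After the q-Leibniz rule, [qconv_swap] moves a shift from one factor to the other; the powers of
    q then depend on k + i only, and m and N drop by one together. *)
Let XS m N : X m N.+1 = (1 - q ^+ m) * q ^+ (m.-1 + N) * X m.-1 N.
Proof.
rewrite /X qconvS.
pose f k i := q ^+ (k + m * i.+1 + m) * b (m + k) * h i.
pose g k i := q ^+ (m * i + (m + k).-1) * (1 - q ^+ (m + k)) * b (m + k).-1 * h i.
transitivity (qconv q (fun k i => g k i + -1 * ((1 - q ^+ k) * f k.-1 i)) N).
  transitivity (qconv q (fun k i => g k i + -1 * ((1 - q ^+ i) * f k i.-1)) N);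
    last first.
    apply: (etrans (qconvD _ _ _ _)); apply: (etrans _ (esym (qconvD _ _ _ _))).
    congr (_ + _); apply: (etrans (qconvZ _ _ _ _)).
    by apply: (etrans _ (esym (qconvZ _ _ _ _))); rewrite qconv_swap.
  apply: eq_qconv => k i _; rewrite /f /g /h /b addnS !qquotS.
  have -> : q ^+ (m * i + (m + k).-1) = q ^+ (m * i) * q ^+ (m + k).-1 by rewrite exprD.
  have -> : q ^+ (m * i.+1) = q ^+ (m * i) * q ^+ m by rewrite mulnS addnC exprD.
  rewrite -/(b (m + k)) -/(b (m + k).-1) -/(h i) -/(h i.-1).
  case: i => [|i]; first by rewrite expr0 exprD; ring.
  rewrite succnK !exprD [q ^+ (m * i.+1)](_ : _ = q ^+ (m * i) * q ^+ m).
    by ring.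
  by rewrite mulnS addnC exprD.
apply: (etrans _ (qconvZ _ _ _ _)); apply: eq_qconv => k i <-; rewrite /f /g {f g}.
case: m => [|m].
  rewrite expr0 subrr !mul0r !mul0n !add0n !addn0.
  by ring.
rewrite succnK !addSn !succnK.
case: k => [|k].
  rewrite expr0 subrr mul0r mulr0 addr0 !addn0 add0n.
  have -> : (m.+1 * i + m = m * i + (m + i))%N by rewrite mulSn; lia.
  by rewrite exprD; ring.
rewrite succnK -addnS.
have -> : (k + m.+1 * i.+1 + m.+1 = m * i + (m + (k.+1 + i)) + m.+1)%N.
  by rewrite mulnS !mulSn; lia.
have -> : (m.+1 * i + (m + k.+1) = m * i + (m + (k.+1 + i)))%N.
  by rewrite !mulSn; lia.
have -> : q ^+ (m + k.+2) = q ^+ m.+1 * q ^+ k.+1 by rewrite -exprD addSnnS.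
rewrite -[(m + k).+1]addnS [q ^+ (_ + m.+1)]exprD [q ^+ (m * i + _)]exprD.
by ring.
Qed.

(** For m = 0 this says that the b and h series are reciprocal. In general it makes the diagonal
    sums for the reciprocal kernel finite. *)
Lemma hermite_shift_conv_small m N : (m < N)%N ->
  qconv q (fun k i => q ^+ (m * i) * b (m + k) * h i) N = 0.
Proof.
rewrite -/(X m N); elim: N m => // N IH m ltmN; rewrite XS.
case: m ltmN => [|m] ltmN; first by rewrite expr0 subrr !mul0r.
by rewrite IH // mulr0.
Qed.

Lemma hermite_shift_conv m N : (N <= m)%N ->
  qpoch q q (m - N) * qconv q (fun k i => q ^+ (m * i) * b (m + k) * h i) N =
  qpoch q q m * q ^+ (m.-1 * N) * b (m - N).
Proof.
rewrite -/(X m N); elim: N m => [|N IH] m leNm.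
  by rewrite subn0 /X qconv0 !muln0 expr0 addn0 /h /qquot /=; ring.
case: m leNm => // m leNm; rewrite XS succnK subSS mulrCA IH // qpochS.
case: m leNm => [|m] leNm.
  move: leNm; rewrite ltnS leqn0 => /eqP ->.
  by rewrite !muln0 !mul0n !expr0 expr1; ring.
have -> : (m.+1 * N.+1 = m * N + (m.+1 + N))%N by rewrite mulnS !mulSn; lia.
by rewrite succnK !exprD exprS; ring.
Qed.

End HermiteConvolution.

(** * Expansions of a quotient of kernels and of a reciprocal kernel *)

Section KernelExpansions.
Variables (R : realType) (q : R).
Hypothesis q1 : `|q| < 1.
Implicit Types (x y z : R).

Lemma gbin_qpoch n k : (k <= n)%N ->
  gbin q n k = qpoch q q n / (qpoch q q k * qpoch q q (n - k)).
Proof.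
move=> lekn; rewrite -gbin_qbinom //; last by left; exact: exp_neq1.
by rewrite /qbinom ifN_eq // -(expr1 q); exact: (exp_neq1 q1).
Qed.

Lemma qquot_scaled_hermite (t y : R) n :
  qquot q (2 * t * y) (t ^+ 2) 0 0 n = t ^+ n * qquot q (2 * y) 1 0 0 n.
Proof. by rewrite -qquotZ; congr qquot; ring. Qed.

(** A double series is summed in two ways: its rows are Carlitz sums, and its diagonals give h_n(x),
    the convolution of the p_k(x|y,rho1) with the rho1^m h_m(y). *)
Lemma hassum_ASC_kernel x y z rho1 rho2 :
  -1 <= x <= 1 -> -1 <= y <= 1 -> -1 <= z <= 1 -> `|rho1| < 1 -> `|rho2| < 1 ->
  hassum (fun n => rho2 ^+ n / (qpoch (rho1 ^+ 2 * rho2 ^+ 2) q n * qpoch q q n)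
            * ASC z y (rho1 * rho2) q n * ASC x y rho1 q n)
    (PM q z x rho2 0 0 / PM q z y (rho1 * rho2) 0 0).
Proof.
move=> hx hy hz h1 h2.
have hb : `|rho1 * rho2| < 1 by rewrite normrM mulr_ilt1.
have [P0 _] := PM_prod q1 hz hy hb.
pose w k := rho2 ^+ k / qpoch q q k * ASC x y rho1 q k.
pose a k m := w k * pmterm q z y (rho1 * rho2) k 0 m.
have ac k : hassum (a k) (w k * PM q z y (rho1 * rho2) k 0).
  by apply: hassumZ; exact: hassum_PM.
have diag : hassum (fun n => \sum_(k < n.+1) a k (n - k)%N) (PM q z x rho2 0 0).
  apply: eq_hassum (@hassum_PM _ _ q1 z x rho2 0 0 hz hx h2) => n; apply: esym.
  rewrite /pmterm !add0n.
  rewrite -(qquot_conv q (2 * x) 1 (2 * rho1 * y) (rho1 ^+ 2) 0 0).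
  rewrite /qconv mulr_sumr; apply: eq_bigr => k _.
  rewrite /a /w /pmterm gbin_qpoch ?leq_ord // subnKC ?leq_ord // add0n.
  rewrite qquot_scaled_hermite -ASC_qquot exprMn.
  have -> : rho2 ^+ n = rho2 ^+ k * rho2 ^+ (n - k) by rewrite -exprD subnKC ?leq_ord.
  have := qpochqq_neq0 q1 n; have := qpochqq_neq0 q1 k.
  have := qpochqq_neq0 q1 (n - k).
  move: (qpoch q q (n - k)) (qpoch q q k) (qpoch q q n) => p1 p2 p3 e1 e2 e3.
  move: (ASC _ _ _ _ _) (qquot _ _ _ _ _ _) (qquot _ _ _ _ _ n) => t1 t2 t3.
  by field; rewrite e1 e2 e3.
have [r r1 sr1] := pick_ratio h2; have r0 : 0 < r by exact: lt_trans r1.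
have [C C0 HC] : exists2 C, 0 <= C &
    forall k m, `|a k m| <= C * (`|rho2| * r ^+ 2) ^+ (k + m).
  have [Cz Cz0 Hz] := qquot_geom_le q1 0 0 hz r1.
  have [Cy Cy0 Hy] := qquot_geom_le q1 0 0 hy r1.
  have [Cx Cx0 Hx] := qquot_geom_le q1 (2 * rho1 * y) (rho1 ^+ 2) hx r1.
  have [|e e0 He] := @qpoch_bounds _ _ q1 `|q|; first by rewrite normr_ge0.
  have Pe m : 0 < qpoch q q m by have /andP[/(lt_le_trans e0)] := He q m (lexx _).
  have Pi m : (qpoch q q m)^-1 <= e^-1.
    by rewrite lef_pV2 ?posrE //; have /andP[] := He q m (lexx _).
  have ei : 0 <= e^-1 by rewrite invr_ge0 ltW.
  exists (e^-1 * e^-1 * Cz * Cy * Cx) => [|k m]; first by rewrite !mulr_ge0.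
  rewrite /a /w /pmterm add0n ASC_qquot !normrM !normfV !normrX normrM.
  rewrite ![`|qpoch _ _ _|]gtr0_norm //.
  (* The three growth factors r^k, r^(k+m) and r^m multiply to (r^2)^(k+m), so after bounding |rho1|
     by 1 the ratio is |rho2| r^2. *)
  apply: (@le_trans _ _ ((`|rho2| ^+ k * e^-1 * (Cx * r ^+ k)) *
     ((1 * `|rho2|) ^+ m * e^-1 * (Cz * r ^+ (k + m)) * (Cy * r ^+ m)))).
    have ip m' : 0 <= (qpoch q q m')^-1 by rewrite invr_ge0 ltW.
    apply: ler_pM; [by rewrite !mulr_ge0 ?exprn_ge0|by rewrite !mulr_ge0 ?exprn_ge0 ?mulr_ge0| |].
      apply: ler_pM => //; first by rewrite mulr_ge0 ?exprn_ge0.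
      by rewrite ler_wpM2l ?exprn_ge0.
    apply: ler_pM => //; first by rewrite !mulr_ge0 ?exprn_ge0 ?mulr_ge0.
    apply: ler_pM => //; first by rewrite !mulr_ge0 ?exprn_ge0 ?mulr_ge0.
    apply: ler_pM => //.
    by apply: lerXn2r; rewrite ?nnegrE ?mulr_ge0 // ler_wpM2r // ltW.
  rewrite mul1r exprMn -exprM mul2n -addnn !exprD.
  by rewrite le_eqVlt; apply/orP; left; apply/eqP; ring.
have sr0 : 0 <= `|rho2| * r ^+ 2 < 1.
  by rewrite sr1 mulr_ge0 // exprn_ge0 // ltW.
rewrite [X in hassum _ X]mulrC.
apply: eq_hassum (hassumZ _ (hassum_rearrange C0 sr0 HC ac diag)) => n.
rewrite /w (@PM_Carlitz _ _ q1 z y _ n) // -exprMn.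
have := P0; have := qpochqq_neq0 q1 n.
have : qpoch ((rho1 * rho2) ^+ 2) q n != 0.
  by apply: qpoch_neq0 => j; rewrite mul_exp_neq1 // sqr_norm_lt1.
move: (PM _ _ _ _ _ _) (qpoch _ _ _) (qpoch q q n) => p1 p2 p3 e1 e2 e3.
by field; rewrite e1 e2 e3.
Qed.

(** For m = 0 this is the reciprocal of the kernel; general m is needed once the summation index is
    split as m + k. The rows are Carlitz sums at beta q^m, and the diagonals of index at most m add
    up to g_m, the others being 0. *)
Lemma hassum_dual_kernel (beta y z : R) m :
  -1 <= y <= 1 -> -1 <= z <= 1 -> `|beta| < 1 ->
  hassum (fun k => beta ^+ k * qquot q 0 0 (2 * z) 1 (m + k)
            * ASC y z (beta * q ^+ m) q k
            / (qpoch q q k * qpoch (beta ^+ 2 * q ^+ (2 * m)) q k))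
    (gpol z y (beta * q ^+ m.-1) q m / PM q y z (beta * q ^+ m) 0 0).
Proof.
move=> hy hz hb; set s := beta * q ^+ m.
have hs : `|s| < 1.
  by rewrite normrM normrX (le_lt_trans _ hb) // ler_piMr // exprn_ile1 // ltW.
have ss : beta ^+ 2 * q ^+ (2 * m) = s ^+ 2 by rewrite /s exprMn mulnC exprM.
have [P0 _] := PM_prod q1 hy hz hs.
pose w k := beta ^+ k / qpoch q q k * qquot q 0 0 (2 * z) 1 (m + k).
pose a k i := w k * pmterm q y z s k 0 i.
have ac k : hassum (a k) (w k * PM q y z s k 0).
  by apply: hassumZ; exact: hassum_PM.
pose f N := beta ^+ N / qpoch q q N * qquot q (2 * y) 1 0 0 N *
  qconv q (fun k i => q ^+ (m * i) * qquot q 0 0 (2 * z) 1 (m + k)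
     * qquot q (2 * z) 1 0 0 i) N.
have diag : hassum (fun n => \sum_(k < n.+1) a k (n - k)%N)
    (gpol z y (beta * q ^+ m.-1) q m).
  have -> : gpol z y (beta * q ^+ m.-1) q m = \sum_(N < m.+1) f N.
    rewrite gpol_qquot -(qquot_conv q _ _ 0 0); apply: eq_bigr => N _.
    have leNm := leq_ord N; rewrite /f gbin_qpoch // qquot_scaled_hermite.
    have := hermite_shift_conv q (2 * z) leNm.
    rewrite exprMn -exprM.
    set X := qconv _ _ _; have := qpochqq_neq0 q1 m; have := qpochqq_neq0 q1 N.
    have := qpochqq_neq0 q1 (m - N).
    move: (qpoch q q (m - N)) (qpoch q q N) (qpoch q q m) => p1 p2 p3 e1 e2 e3 e.
    have -> : X = p3 * q ^+ (m.-1 * N) * qquot q 0 0 (2 * z) 1 (m - N) / p1.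
      by rewrite -e mulrC mulKf.
    move: (qquot _ _ _ _ _ _) (qquot _ _ _ _ _ N) => t1 t2.
    by move: (q ^+ (m.-1 * N)) => Q; field; rewrite e1 e2.
  have f0 N : (m.+1 <= N)%N -> f N = 0.
    by move=> ltmN; rewrite /f hermite_shift_conv_small ?mulr0.
  apply: eq_hassum (hassum_finite f0) => N.
  rewrite /f /qconv mulr_sumr; apply: eq_bigr => k _.
  rewrite /a /w /pmterm gbin_qpoch ?leq_ord // subnKC ?leq_ord // add0n /s.
  rewrite exprMn -exprM.
  have -> : beta ^+ N = beta ^+ k * beta ^+ (N - k) by rewrite -exprD subnKC ?leq_ord.
  have := qpochqq_neq0 q1 N; have := qpochqq_neq0 q1 k.
  have := qpochqq_neq0 q1 (N - k).
  move: (qpoch q q (N - k)) (qpoch q q k) (qpoch q q N) => p1 p2 p3 e1 e2 e3.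
  move: (qquot _ _ _ _ _ _) (qquot _ _ _ _ _ _) (qquot _ _ _ _ _ _) => t1 t2 t3.
  by move: (q ^+ (m * (N - k))) => Q; field; rewrite e1 e2 e3.
have [r r1 sr1] := pick_ratio hb; have r0 : 0 < r by exact: lt_trans r1.
have [C C0 HC] : exists2 C, 0 <= C &
    forall k i, `|a k i| <= C * (`|beta| * r ^+ 2) ^+ (k + i).
  have [Cz Cz0 Hz] := qquot_geom_le q1 0 0 hz r1.
  have [Cy Cy0 Hy] := qquot_geom_le q1 0 0 hy r1.
  have [Cb Cb0 Hb] := qquot0_geom_le q1 (2 * z) 1 (@ltr01 R).
  have [|e e0 He] := @qpoch_bounds _ _ q1 `|q|; first by rewrite normr_ge0.
  have Pe l : 0 < qpoch q q l by have /andP[/(lt_le_trans e0)] := He q l (lexx _).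
  have Pi l : (qpoch q q l)^-1 <= e^-1.
    by rewrite lef_pV2 ?posrE //; have /andP[] := He q l (lexx _).
  have ei : 0 <= e^-1 by rewrite invr_ge0 ltW.
  exists (e^-1 * e^-1 * Cz * Cy * Cb) => [|k i]; first by rewrite !mulr_ge0.
  have rk : 1 <= r ^+ k by rewrite exprn_ege1 // ltW.
  rewrite /a /w /pmterm add0n !normrM !normfV !normrX.
  rewrite ![`|qpoch _ _ _|]gtr0_norm //.
  apply: (@le_trans _ _ ((`|beta| ^+ k * e^-1 * (Cb * r ^+ k)) *
     (`|beta| ^+ i * e^-1 * (Cy * r ^+ (k + i)) * (Cz * r ^+ i)))).
    have ip l : 0 <= (qpoch q q l)^-1 by rewrite invr_ge0 ltW.
    apply: ler_pM; [by rewrite !mulr_ge0 ?exprn_ge0|by rewrite !mulr_ge0 ?exprn_ge0| |].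
      apply: ler_pM => //; first by rewrite mulr_ge0 ?exprn_ge0.
        by rewrite ler_wpM2l ?exprn_ge0.
      by apply: le_trans (Hb _) _; rewrite expr1n ler_wpM2l.
    apply: ler_pM => //; first by rewrite !mulr_ge0 ?exprn_ge0.
    apply: ler_pM => //; first by rewrite !mulr_ge0 ?exprn_ge0.
    apply: ler_pM => //.
    apply: lerXn2r; rewrite ?nnegrE // /s normrM normrX.
    by rewrite ler_piMr // exprn_ile1 // ltW.
  rewrite exprMn -exprM mul2n -addnn !exprD.
  by rewrite le_eqVlt; apply/orP; left; apply/eqP; ring.
have sr0 : 0 <= `|beta| * r ^+ 2 < 1.
  by rewrite sr1 mulr_ge0 // exprn_ge0 // ltW.
rewrite [X in hassum _ X]mulrC.
apply: eq_hassum (hassumZ _ (hassum_rearrange C0 sr0 HC ac diag)) => k.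
rewrite /w (@PM_Carlitz _ _ q1 y z _ k) // ss.
have := P0; have := qpochqq_neq0 q1 k.
have : qpoch (s ^+ 2) q k != 0.
  by apply: qpoch_neq0 => j; rewrite mul_exp_neq1 // sqr_norm_lt1.
move: (PM _ _ _ _ _ _) (qpoch _ _ _) (qpoch q q k) => p1 p2 p3 e1 e2 e3.
by field; rewrite e1 e2 e3.
Qed.

End KernelExpansions.

(** * Expansion in Askey-Wilson polynomials *)

Section AWExpansion.
Variables (R : realType) (q : R).
Hypothesis q1 : `|q| < 1.

Lemma gbin_le : exists2 C : R, 0 <= C & forall n k, (k <= n)%N -> `|gbin q n k| <= C.
Proof.
have [|e e0 He] := @qpoch_bounds _ _ q1 `|q|; first by rewrite normr_ge0.
have Pe n : 0 < qpoch q q n by have /andP[/(lt_le_trans e0)] := He q n (lexx _).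
have Pu n : qpoch q q n <= e^-1 by have /andP[] := He q n (lexx _).
have Pi n : (qpoch q q n)^-1 <= e^-1.
  by rewrite lef_pV2 ?posrE //; have /andP[] := He q n (lexx _).
have ei : 0 <= e^-1 by rewrite invr_ge0 ltW.
exists (e^-1 * (e^-1 * e^-1)) => [|n k lekn]; first by rewrite !mulr_ge0.
rewrite gbin_qpoch // invfM !normrM !normfV ![`|qpoch _ _ _|]gtr0_norm //.
have ip l : 0 <= (qpoch q q l)^-1 by rewrite invr_ge0 ltW.
by apply: ler_pM; rewrite ?mulr_ge0 // ?(ltW (Pe _)) //; apply: ler_pM.
Qed.

(** Each of the m + 1 <= 2^m terms is at most a constant times 8^(m-j) 8^j. *)
Lemma AWalpha_crude (x y z rho1 rho2 : R) :
  -1 <= x <= 1 -> -1 <= y <= 1 -> -1 <= z <= 1 -> `|rho1| < 1 -> `|rho2| < 1 ->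
  geom_le (AWalpha x y rho1 z rho2 q) 16.
Proof.
move=> hx hy hz h1 h2; have [G G0 HG] := gbin_le.
have n2 (t : R) : -1 <= t <= 1 -> `|t| <= 1 by rewrite ler_norml.
have r1 : `|rho1 ^+ 2| <= `|rho1|.
  by rewrite normrX expr2 ler_piMr // ltW.
have [|e e0 He] := @qpoch_bounds _ _ q1 `|rho1|; first by rewrite normr_ge0.
have ei : 0 <= e^-1 by rewrite invr_ge0 ltW.
have qX k : `|q ^+ k| <= 1 by rewrite normrX exprn_ile1 // ltW.
have P1 j n : `|qpoch (rho1 ^+ 2 * q ^+ j) q n| <= e^-1.
  have /andP[a b] : e <= qpoch (rho1 ^+ 2 * q ^+ j) q n <= e^-1.
    by apply: He; rewrite normrM (le_trans _ r1) // ler_piMr.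
  by rewrite ger0_norm // (le_trans _ a) // ltW.
have P2 j n : `|(qpoch (rho1 ^+ 2 * rho2 ^+ 2 * q ^+ j) q n)^-1| <= e^-1.
  have /andP[a b] : e <= qpoch (rho1 ^+ 2 * rho2 ^+ 2 * q ^+ j) q n <= e^-1.
    apply: He; rewrite -mulrA normrM (le_trans _ r1) // ler_piMr //.
    by rewrite normrM mulr_ile1 // normrX exprn_ile1 // ltW.
  have a' : 0 < qpoch (rho1 ^+ 2 * rho2 ^+ 2 * q ^+ j) q n by exact: lt_le_trans a.
  by rewrite normfV gtr0_norm // lef_pV2 ?posrE.
exists (G * (e^-1 * e^-1)) => [|m]; first by rewrite !mulr_ge0.
rewrite AWalpha_AWcoef; last exact: exp_neq1.
apply: le_trans (ler_norm_sum _ _ _) _.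
apply: (@le_trans _ _ (\sum_(j < m.+1) G * (e^-1 * e^-1) * 8 ^+ m)).
  apply: ler_sum => j _; have lejm := leq_ord j.
  have hg : `|gpol z y (rho1 * rho2 * q ^+ m.-1) q (m - j)| <= 8 ^+ (m - j).
    have t1 : `|rho1 * rho2 * q ^+ m.-1| <= 1.
      by rewrite normrM mulr_ile1 // normrM mulr_ile1 // ltW.
    rewrite gpol_qquot; apply: qquot_crude => //.
    - rewrite -mulrA normrM normr_nat ler_piMr // normrM mulr_ile1 //; exact: n2.
    - by rewrite normrM normr_nat ler_piMr //; exact: n2.
    - by rewrite normrX exprn_ile1.
    - by rewrite normr1.
  have hp : `|ASC x y rho1 q j| <= 8 ^+ j.
    rewrite ASC_qquot; apply: qquot_crude => //.
    - by rewrite normrM normr_nat ler_piMr //; exact: n2.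
    - rewrite -mulrA normrM normr_nat ler_piMr // normrM mulr_ile1 //.
        exact: ltW.
      exact: n2.
    - by rewrite normr1.
    - by rewrite normrX exprn_ile1 // ltW.
  have -> : 8 ^+ m = 8 ^+ (m - j) * 8 ^+ j :> R by rewrite -exprD subnK.
  rewrite /AWcoef normrM [leRHS]mulrA.
  apply: ler_pM => //; rewrite normrM; apply: ler_pM => //.
  rewrite normrM; apply: ler_pM => //; first exact: HG.
  rewrite !normrM; apply: ler_pM => //.
  rewrite -[leRHS]mul1r; apply: ler_pM => //.
  by rewrite normrX exprn_ile1 // ltW.
rewrite sumr_const card_ord -[leLHS]mulr_natl [leLHS]mulrCA.
apply: ler_wpM2l; first by rewrite !mulr_ge0.
have -> : 16 = 2 * 8 :> R by rewrite -natrM.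
rewrite exprMn; apply: ler_wpM2r; first by rewrite exprn_ge0.
by rewrite -natrX ler_nat ltn_expl.
Qed.

Lemma hassum_AW_kernel (x y z rho1 rho2 : R) :
  -1 <= x <= 1 -> -1 <= y <= 1 -> -1 <= z <= 1 -> `|rho1| < 1 -> `|rho2| < 1 ->
  hassum (fun n => rho2 ^+ n * qpoch (rho1 ^+ 2 * rho2 ^+ 2) q (2 * n)
       / ((\prod_(j < n) AWw y z (rho1 * rho2 * q ^+ j))
          * (qpoch (rho2 ^+ 2) q n * qpoch q q n))
       * gpol z y (rho1 * rho2 * q ^+ n.-1) q n
       * AWalpha x y rho1 z rho2 q n)
    (PM q z y (rho1 * rho2) 0 0 / PM q z x rho2 0 0).
Proof.
move=> hx hy hz h1 h2; set be := rho1 * rho2.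
have hb : `|be| < 1 by rewrite normrM mulr_ilt1.
have hq k : (0 < k)%N -> q ^+ k != 1 by exact: exp_neq1.
have hb2 k : rho1 ^+ 2 * rho2 ^+ 2 * q ^+ k != 1.
  by rewrite -exprMn mul_exp_neq1 // sqr_norm_lt1.
have hb2' k : rho2 ^+ 2 * rho1 ^+ 2 * q ^+ k != 1 by rewrite [_ * rho1 ^+ 2]mulrC.
have [P0 _] := PM_prod q1 hy hz hb.
have r20 n : qpoch (rho2 ^+ 2) q n != 0.
  by apply: qpoch_neq0 => j; rewrite mul_exp_neq1 // sqr_norm_lt1.
have qq0 := qpochqq_neq0 q1.
have be0 n : qpoch (be ^+ 2) q n != 0.
  by apply: qpoch_neq0 => j; rewrite mul_exp_neq1 // sqr_norm_lt1.
pose bz n := qquot q 0 0 (2 * z) 1 n.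
pose al := AWalpha x z rho2 y rho1 q.
pose d m k := be ^+ k * bz (m + k)%N * ASC y z (be * q ^+ m) q k
            / (qpoch q q k * qpoch (be ^+ 2 * q ^+ (2 * m)) q k).
pose w m := rho2 ^+ m / (qpoch (rho2 ^+ 2) q m * qpoch q q m) * al m.
pose a m k := w m * d m k.
have ac m : hassum (a m)
    (w m * (gpol z y (be * q ^+ m.-1) q m / PM q y z (be * q ^+ m) 0 0)).
  by apply: hassumZ; exact: hassum_dual_kernel.
(* The diagonals come from the case m = 0 of [hassum_dual_kernel] at (x, z), with p_n(x|z,rho2)
   rewritten by [ASC_AWalpha]. *)
have diag : hassum (fun n => \sum_(m < n.+1) a m (n - m)%N) (PM q x z rho2 0 0)^-1.
  have := @hassum_dual_kernel _ _ q1 rho2 x z 0 hx hz h2.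
  rewrite /gpol eqxx expr0 mulr1 mul1r; apply: eq_hassum => n.
  rewrite !mulr1 add0n (@ASC_AWalpha _ q x z rho2 y rho1 n hq hb2').
  rewrite mulr_sumr mulr_suml; apply: eq_bigr => m _.
  have lemn := leq_ord m; rewrite /a /w /d /al gbin_qpoch // subnKC // -/(bz n).
  have -> : rho2 ^+ n = rho2 ^+ m * rho2 ^+ (n - m) by rewrite -exprD subnKC.
  have -> : qpoch (rho2 ^+ 2) q n =
    qpoch (rho2 ^+ 2) q m * qpoch (rho2 ^+ 2 * q ^+ m) q (n - m).
    by rewrite -qpochD subnKC.
  have : qpoch (rho2 ^+ 2 * q ^+ m) q (n - m) != 0.
    by apply: qpoch_neq0 => j; rewrite -mulrA -exprD mul_exp_neq1 // sqr_norm_lt1.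
  have : qpoch (be ^+ 2 * q ^+ (2 * m)) q (n - m) != 0.
    by apply: qpoch_neq0 => j; rewrite -mulrA -exprD mul_exp_neq1 // sqr_norm_lt1.
  have -> : rho2 ^+ 2 * rho1 ^+ 2 = be ^+ 2 by rewrite /be; ring.
  have -> : rho2 * rho1 = be by rewrite mulrC.
  have -> : be ^+ (n - m) = rho1 ^+ (n - m) * rho2 ^+ (n - m) by rewrite exprMn.
  have := qq0 n; have := qq0 m; have := qq0 (n - m)%N; have := r20 m.
  move: (qpoch (rho2 ^+ 2) q m) (qpoch q q (n - m)) (qpoch q q m) (qpoch q q n).
  move: (qpoch (be ^+ 2 * _) _ _) (qpoch (rho2 ^+ 2 * _) _ _) (ASC _ _ _ _ _).
  move: (AWalpha _ _ _ _ _ _ _) (bz n) (rho1 ^+ (n - m)) (rho2 ^+ (n - m)).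
  move: (rho2 ^+ m) => t1 t2 t3 t4 t5 s1 s2 s3 p1 p2 p3 p4 e1 e2 e3 e4 e5 e6.
  by field; rewrite e1 e2 e3 e4 e5 e6.
have [C C0 HC] : exists2 C, 0 <= C &
    forall m k, `|a m k| <= C * (1 / 2) ^+ (m + k).
  have [Ca Ca0 Ha] := AWalpha_crude hx hz hy h2 h1.
  (* The rate 1/32 outweighs 16^m from alpha_m and 8^k <= 16^k from p_k and leaves the ratio 1/2. *)
  have [|Cb Cb0 Hb] := @qquot0_geom_le _ _ q1 (2 * z) 1 (1 / 32); first by lra.
  have [|e e0 He] := @qpoch_bounds _ _ q1 (Num.max `|q| (Num.max `|rho2| `|be|)).
    by rewrite le_max normr_ge0 !gt_max q1 h2 hb.
  have ei : 0 <= e^-1 by rewrite invr_ge0 ltW.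
  have bV (b : R) n : `|b| <= Num.max `|q| (Num.max `|rho2| `|be|) ->
      `|(qpoch b q n)^-1| <= e^-1.
    move=> hbb; have /andP[l _] := He b n hbb.
    have l0 : 0 < qpoch b q n by exact: lt_le_trans l.
    by rewrite normfV gtr0_norm // lef_pV2 ?posrE.
  have V1 n : `|(qpoch q q n)^-1| <= e^-1 by apply: bV; rewrite le_max lexx.
  have V2 n : `|(qpoch (rho2 ^+ 2) q n)^-1| <= e^-1.
    apply: bV; rewrite !le_max; apply/orP; right; apply/orP; left.
    by rewrite normrX expr2 ler_piMr // ltW.
  have V3 m n : `|(qpoch (be ^+ 2 * q ^+ m) q n)^-1| <= e^-1.
    apply: bV; rewrite !le_max; apply/orP; right; apply/orP; right.
    rewrite normrM; apply: (@le_trans _ _ `|be ^+ 2|).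
      by rewrite ler_piMr // normrX exprn_ile1 // ltW.
    by rewrite normrX expr2 ler_piMr // ltW.
  have hp m k : `|ASC y z (be * q ^+ m) q k| <= 8 ^+ k.
    have t1 : `|be * q ^+ m| <= 1.
      by rewrite normrM mulr_ile1 // ?normrX ?exprn_ile1 // ltW.
    have n2 (t : R) : -1 <= t <= 1 -> `|t| <= 1 by rewrite ler_norml.
    rewrite ASC_qquot; apply: qquot_crude => //.
    - by rewrite normrM normr_nat ler_piMr //; exact: n2.
    - by rewrite -mulrA normrM normr_nat ler_piMr // normrM mulr_ile1 //; exact: n2.
    - by rewrite normr1.
    - by rewrite normrX exprn_ile1.
  exists (1 * (e^-1 * e^-1) * Ca * (1 * Cb * 1 * (e^-1 * e^-1))) => [|m k].
    by rewrite !mulr_ge0.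
  have X1 (t : R) n : `|t| < 1 -> `|t ^+ n| <= 1.
    by move=> ht; rewrite normrX exprn_ile1 // ltW.
  have -> : 1 * (e^-1 * e^-1) * Ca * (1 * Cb * 1 * (e^-1 * e^-1))
      * (1 / 2) ^+ (m + k) =
    (1 * (e^-1 * e^-1) * (Ca * 16 ^+ m)) * (1 * (Cb * (1 / 32) ^+ (m + k)) * 16 ^+ k
       * (e^-1 * e^-1)).
    have -> : (1 / 2) ^+ (m + k) = 16 ^+ m * 16 ^+ k * (1 / 32) ^+ (m + k) :> R.
      by rewrite -exprD -exprMn; congr (_ ^+ _); field.
    by ring.
  rewrite normrM; apply: ler_pM => //.
    rewrite /w normrM; apply: ler_pM => //; rewrite normrM; apply: ler_pM => //.
      exact: X1.
    by rewrite invfM normrM; apply: ler_pM.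
  rewrite /d normrM; apply: ler_pM => //.
    rewrite normrM; apply: ler_pM => //.
      by rewrite normrM; apply: ler_pM => //; exact: X1.
    by apply: le_trans (hp _ _) _; apply: lerXn2r; rewrite ?nnegrE //; lra.
  by rewrite invfM normrM; apply: ler_pM.
have r01 : 0 <= (1 / 2 : R) < 1 by lra.
rewrite [X in hassum _ (_ / X)]PM_sym [X in hassum _ (X / _)]PM_sym.
apply: eq_hassum (hassumZ _ (hassum_rearrange C0 r01 HC ac diag)) => n.
(* Symmetry restores the order of the parameters; [PM_iter] then trades the kernel at be q^n for the
   one at be, which produces the product of the w and (be^2)_(2n). *)
rewrite /w /al -(@AWalpha_sym _ q x y rho1 z rho2 n hq hb2) -exprMn -/be.
have it := PM_iter q1 n hy hz hb.
have [Pn _] : PM q y z (be * q ^+ n) 0 0 != 0 /\ True.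
  split => //; have hbn : `|be * q ^+ n| < 1.
    by rewrite normrM normrX (le_lt_trans _ hb) // ler_piMr // exprn_ile1 // ltW.
  by have [] := PM_prod q1 hy hz hbn.
have w0 : \prod_(j < n) AWw y z (be * q ^+ j) != 0.
  have : qpoch (be ^+ 2) q (2 * n) * PM q y z (be * q ^+ n) 0 0 != 0.
    by rewrite mulf_neq0.
  by rewrite it mulf_eq0 negb_or => /andP[].
have -> : PM q y z (be * q ^+ n) 0 0 =
  \prod_(j < n) AWw y z (be * q ^+ j) * PM q y z be 0 0 / qpoch (be ^+ 2) q (2 * n).
  by apply: (mulfI (be0 (2 * n)%N)); rewrite it mulrCA divff ?be0 // mulr1.
have := r20 n; have := qq0 n; have := be0 (2 * n)%N.
move: P0 w0; move: (\prod_(j < n) _) (PM q y z be 0 0) (qpoch (be ^+ 2) q (2 * n)).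
move: (qpoch q q n) (qpoch (rho2 ^+ 2) q n) (gpol _ _ _ _ _) (AWalpha _ _ _ _ _ _ _).
move: (rho2 ^+ n) => t1 p1 p2 t2 t3 p3 p4 p5 e1 e2 e3 e4 e5.
by field; rewrite e1 e2 e3 e4 e5.
Qed.

End AWExpansion.

Local Open Scope complex_scope.

(* The printed form of (ii) contains misprints that make both of its identities
   false; the corrected identities are stated here: f_CN(z|x,rho2,q) replaces
   f_CN(x|z,rho2,q) in both, and in the second one the product of the w's is in
   the denominator and the factor (rho1^2 rho2^2 q^(n-1))_n^2 is absent. *)
Theorem theorem8 (R : realType) (q : R) (hq : -1 < q <= 1) :
  (forall (n : nat) (z y beta : R[i]),
     (1 <= n)%N ->
     (forall k : nat, beta ^+ 2 * q%:C ^+ k != 1) ->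
     0 = \sum_(j < n.+1)
           qbinom q%:C n j * qpoch (beta ^+ 2 * q%:C ^+ j) q%:C n.-1
           * ASC z y beta q%:C j
           * gpol z y (beta * q%:C ^+ n.-1) q%:C (n - j)
     /\
     0 = \sum_(j < n.+1)
           qbinom q%:C n j
           * (if j == 0%N :> nat then
                ASC z y beta q%:C n
                / (qpoch (beta ^+ 2) q%:C n.-1
                   * (1 - beta ^+ 2 * q%:C ^+ n.-1))
              else
                ASC z y (beta * q%:C ^+ j) q%:C (n - j)
                * gpol z y (beta * q%:C ^+ j.-1) q%:C j
                * (1 - beta ^+ 2 * q%:C ^+ (2 * j).-1)
                / (qpoch (beta ^+ 2 * q%:C ^+ j.-1) q%:C n
                   * (1 - beta ^+ 2 * q%:C ^+ (n + j).-1))))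
  /\
  (forall (n : nat) (beta : R[i]),
     (1 <= n)%N ->
     (forall k : nat, beta * q%:C ^+ k != 1) ->
     0 = \sum_(k < n.+1)
           (-1) ^+ k * q%:C ^+ 'C(k, 2) * qbinom q%:C n k
           * qpoch (beta * q%:C ^+ (n - k)) q%:C n.-1
     /\
     0 = \sum_(k < n.+1)
           (-1) ^+ k * q%:C ^+ 'C(k, 2) * qbinom q%:C n k
           * ((1 - beta * q%:C ^+ (2 * k))
              / qpoch (beta * q%:C ^+ k) q%:C n.+1))
  /\
  (forall x y z rho1 rho2 : R,
     -1 <= x <= 1 -> `|y| < 1 -> `|z| < 1 -> `|rho1| < 1 -> `|rho2| < 1 ->
     `|q| < 1 ->
     let u := fun n : nat =>
       rho2 ^+ n / (qpoch (rho1 ^+ 2 * rho2 ^+ 2) q n * qpoch q q n)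
       * ASC z y (rho1 * rho2) q n * ASC x y rho1 q n in
     let v := fun n : nat =>
       rho2 ^+ n * qpoch (rho1 ^+ 2 * rho2 ^+ 2) q (2 * n)
       / ((\prod_(j < n) AWw y z (rho1 * rho2 * q ^+ j))
          * (qpoch (rho2 ^+ 2) q n * qpoch q q n))
       * gpol z y (rho1 * rho2 * q ^+ n.-1) q n
       * AWalpha x y rho1 z rho2 q n in
     (cvgn (series u) /\
      fCN z x rho2 q = fCN z y (rho1 * rho2) q * limn (series u))
     /\
     (cvgn (series v) /\
      fCN z y (rho1 * rho2) q = fCN z x rho2 q * limn (series v))).
Proof.
have [q1l q1u] := andP hq.
have hqC : (forall m, (0 < m)%N -> q%:C ^+ m != 1) \/ q%:C = 1.
  have [->|qN1] := eqVneq q 1; [by right|left => m m0].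
  have q1 : `|q| < 1 by rewrite ltr_norml q1l lt_neqAle qN1.
  rewrite -rmorphXn; apply/negP => /eqP [] /eqP.
  by apply/negP; apply: exp_neq1.
split; [|split].
- move=> n z y beta n0 hb; split; apply: esym.
    exact: sum_ASC_gpol.
  exact: sum_ASC_gpol_dual.
- move=> n beta n0 hb; split; apply: esym; first exact: sum_sign_qpoch.
  exact: sum_sign_qpochV.
move=> x y z rho1 rho2 hx hy hz h1 h2 q1 u v.
have hy' : -1 <= y <= 1 by rewrite -ler_norml ltW.
have hz' : -1 <= z <= 1 by rewrite -ler_norml ltW.
have hb : `|rho1 * rho2| < 1 by rewrite normrM mulr_ilt1.
(* All densities involved are taken at z and share the factor [fh z q], so both identities reduce to
   quotients of kernels. *)
have fCN_PM t s : -1 <= t <= 1 -> `|s| < 1 -> fCN z t s q = fh z q * PM q z t s 0 0.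
  by move=> ht hs; have [_ ->] := PM_prod q1 hz' ht hs.
have [Py _] := PM_prod q1 hz' hy' hb; have [Px _] := PM_prod q1 hz' hx h2.
have hu := hassum_ASC_kernel q1 hx hy' hz' h1 h2.
have hv := hassum_AW_kernel q1 hx hy' hz' h1 h2.
split; split; [exact: cvgP hu| |exact: cvgP hv|].
  rewrite !fCN_PM // (hassum_lim hu).
  by rewrite -mulrA [X in _ = _ * X]mulrC divfK.
rewrite !fCN_PM // (hassum_lim hv).
by rewrite -mulrA [X in _ = _ * X]mulrC divfK.
Qed.
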